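(* For $n=3,4,5$, the number of gaussoids on $[n]$ and the numbers of orbits of gaussoids under the groups $S_n$, $\mathbb{Z}/2\mathbb{Z}\rtimes S_n$ and $(\mathbb{Z}/2\mathbb{Z})^n\rtimes S_n$ are as follows. For $n=3$: $11$ gaussoids; $5$ orbits for $S_3$; $4$ orbits for $\mathbb{Z}/2\mathbb{Z}\rtimes S_3$; $4$ orbits for $(\mathbb{Z}/2\mathbb{Z})^3\rtimes S_3$. For $n=4$: $679$ gaussoids; $58$ orbits for $S_4$; $42$ orbits for $\mathbb{Z}/2\mathbb{Z}\rtimes S_4$; $19$ orbits for $(\mathbb{Z}/2\mathbb{Z})^4\rtimes S_4$. For $n=5$: $60{,}212{,}776$ gaussoids; $508{,}817$ orbits for $S_5$; $254{,}826$ orbits for $\mathbb{Z}/2\mathbb{Z}\rtimes S_5$; $16{,}981$ orbits for $(\mathbb{Z}/2\mathbb{Z})^5\rtimes S_5$.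
   Context: $[n]=\{1,\dots,n\}$ and $\mathcal{A}=\{a_{ij|K}: i,j\in[n]\text{ distinct},\,K\subseteq[n]\setminus\{i,j\}\}$ with $a_{ij|K}=a_{ji|K}$. The symbol $a_{ij|K}$ is identified with the $2$-face $\{I:K\subseteq I\subseteq K\cup\{i,j\}\}$ of the $n$-cube. Write $ijL$ for $\{i,j\}\cup L$, etc. A subset $\mathcal{G}\subseteq\mathcal{A}$ is a gaussoid on $[n]$ if for all pairwise distinct $i,j,k\in[n]$ and all $L\subseteq[n]\setminus\{i,j,k\}$: (G1) $\{a_{ij|L},a_{ik|jL}\}\subset\mathcal{G}$ implies $\{a_{ik|L},a_{ij|kL}\}\subset\mathcal{G}$; (G2) $\{a_{ij|kL},a_{ik|jL}\}\subset\mathcal{G}$ implies $\{a_{ij|L},a_{ik|L}\}\subset\mathcal{G}$; (G3) $\{a_{ij|L},a_{ik|L}\}\subset\mathcal{G}$ implies $\{a_{ij|kL},a_{ik|jL}\}\subset\mathcal{G}$; (G4) $\{a_{ij|L},a_{ij|kL}\}\subset\mathcal{G}$ implies $a_{ik|L}\in\mathcal{G}$ or $a_{jk|L}\in\mathcal{G}$. Group actions on the set of gaussoids. $S_n$ acts by permuting the indices $1,\dots,n$. The group $(\mathbb{Z}/2\mathbb{Z})^n\rtimes S_n$ is the hyperoctahedral group, acting as the full symmetry group of the $n$-cube on its $2$-faces: the generator of the $u$-th factor $\mathbb{Z}/2\mathbb{Z}$ fixes $a_{ij|K}$ if $u\in\{i,j\}$, and otherwise replaces $K$ by its symmetric difference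 with $\{u\}$. The group $\mathbb{Z}/2\mathbb{Z}\rtimes S_n$ is the subgroup generated by $S_n$ and the diagonal element of $(\mathbb{Z}/2\mathbb{Z})^n$, which acts as duality $a_{ij|K}\mapsto a_{ij|[n]\setminus(K\cup\{i,j\})}$. *)

(* Defs.v *)
From mathcomp Require Import all_boot all_fingroup.

Set Implicit Arguments.
Unset Strict Implicit.
Unset Printing Implicit Defensive.

Local Open Scope group_scope.

(* The ground set [n] = {1, ..., n} is represented by 'I_n = {0, ..., n-1}. The
   symbol a_{ij|K} is the pair ({i, j}, K); since {i, j} is a set,
   a_{ij|K} = a_{ji|K}. Pairs that are not of this form belong to the type
   [symbol n] but not to the set [symbols n]. *)
Definition symbol (n : nat) : finType := ({set 'I_n} * {set 'I_n})%type.

Definition symbols (n : nat) : {set symbol n} :=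
  [set a : symbol n | (#|a.1| == 2) && [disjoint a.1 & a.2]].

Definition sym n (i j : 'I_n) (K : {set 'I_n}) : symbol n := ([set i; j], K).

Section Gaussoid.
Variables (n : nat) (G : {set symbol n}).
Implicit Types (i j k : 'I_n) (L : {set 'I_n}).

Definition G1 i j k L : bool :=
  (sym i j L \in G) && (sym i k (j |: L) \in G) ==>
  (sym i k L \in G) && (sym i j (k |: L) \in G).

Definition G2 i j k L : bool :=
  (sym i j (k |: L) \in G) && (sym i k (j |: L) \in G) ==>
  (sym i j L \in G) && (sym i k L \in G).

Definition G3 i j k L : bool :=
  (sym i j L \in G) && (sym i k L \in G) ==>
  (sym i j (k |: L) \in G) && (sym i k (j |: L) \in G).

Definition G4 i j k L : bool :=
  (sym i j L \in G) && (sym i j (k |: L) \in G) ==>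
  (sym i k L \in G) || (sym j k L \in G).

Definition gaussoid : bool :=
  (G \subset symbols n) &&
  [forall i : 'I_n, forall j : 'I_n, forall k : 'I_n, forall L : {set 'I_n},
     uniq [:: i; j; k] && [disjoint [set i; j; k] & L] ==>
     [&& G1 i j k L, G2 i j k L, G3 i j k L & G4 i j k L]].

End Gaussoid.

Definition gaussoids (n : nat) : {set {set symbol n}} :=
  [set G : {set symbol n} | gaussoid G].

Definition relabel_fun n (s : 'S_n) (a : symbol n) : symbol n :=
  (s @: a.1, s @: a.2).

Lemma relabel_inj n (s : 'S_n) : injective (relabel_fun s).
Proof.
move=> [P K] [Q L] /= [/(imset_inj (@perm_inj _ s)) ->].
by move/(imset_inj (@perm_inj _ s)) ->.
Qed.

Definition relabel n (s : 'S_n) : {perm symbol n} := perm (@relabel_inj n s).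

Definition flip_fun n (u : 'I_n) (a : symbol n) : symbol n :=
  if u \in a.1 then a
  else (a.1, (a.2 :\: [set u]) :|: ([set u] :\: a.2)).

Lemma flip_inj n (u : 'I_n) : injective (flip_fun u).
Proof.
apply: (can_inj (g := flip_fun u)) => -[P K].
rewrite /flip_fun /=; case uP: (u \in P); rewrite /= uP //.
congr (_, _); apply/setP => x; rewrite !inE.
by case: (x == u); case: (x \in K).
Qed.

Definition flip n (u : 'I_n) : {perm symbol n} := perm (@flip_inj n u).

(* The diagonal element of (Z/2)^n; the factors commute. *)
Definition duality n : {perm symbol n} := \prod_(u : 'I_n) flip u.

(* The groups S_n, Z/2 x| S_n and (Z/2)^n x| S_n, as groups of permutations of
   the symbols; see [twisted_group_sdprod] and [hyperoctahedral_group_sdprod]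
   for the semidirect product decompositions. *)
Definition relabel_group n : {group {perm symbol n}} :=
  <<[set relabel s | s : 'S_n]>>%G.

Definition flip_group n : {group {perm symbol n}} :=
  <<[set flip u | u : 'I_n]>>%G.

Definition twisted_group n : {group {perm symbol n}} :=
  (<[duality n]> <*> relabel_group n)%G.

Definition hyperoctahedral_group n : {group {perm symbol n}} :=
  (flip_group n <*> relabel_group n)%G.

(* 'P^* is the action of permutations of the symbols on sets of symbols. *)
Definition num_orbits n (H : {group {perm symbol n}}) : nat :=
  #|[set orbit ('P^*)%act H G | G in gaussoids n]|.

Lemma relabelE n (s : 'S_n) (i j : 'I_n) K :
  relabel s (sym i j K) = sym (s i) (s j) (s @: K).
Proof. by rewrite permE /relabel_fun /sym /= imsetU1 imset_set1. Qed.

Lemma relabelM n : {morph @relabel n : s t / s * t}.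
Proof.
move=> s t; apply/permP => -[P K]; rewrite permM !permE /relabel_fun /=.
by rewrite -!imset_comp; congr (_, _); apply: eq_imset => x; rewrite permM.
Qed.

Lemma relabel_groupE n : relabel_group n = [set relabel s | s : 'S_n] :> {set _}.
Proof.
apply: (@gen_set_id _ _ (introT group_setP _)); split.
  apply/imsetP; exists 1 => //; apply: (mulgI (relabel 1)).
  by rewrite -relabelM !mulg1.
move=> _ _ /imsetP[s _ ->] /imsetP[t _ ->].
by rewrite -relabelM imset_f.
Qed.

Lemma flipE n (u : 'I_n) (a : symbol n) :
  flip u a =
    (a.1, [set x | if x == u then (x \in a.2) (+) (x \notin a.1) else x \in a.2]).
Proof.
rewrite permE /flip_fun; case: a => P K /=; case: ifP => uP; congr (_, _);
  apply/setP => x; rewrite !inE; case: eqP => [->|_]; rewrite ?uP ?addbF //=.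
- by case: (u \in K).
- by rewrite andbF orbF.
Qed.

Lemma prod_flipE n (r : seq 'I_n) (a : symbol n) : uniq r ->
  (\prod_(u <- r) flip u) a =
    (a.1, [set x | (x \in a.2) (+) ((x \in r) && (x \notin a.1))]).
Proof.
elim: r a => [|u r IHr] a /=.
  move=> _; rewrite big_nil perm1; case: a => P K /=; congr (_, _).
  by apply/setP => x; rewrite !inE addbF.
case/andP=> ur r_uniq; rewrite big_cons permM IHr // flipE /=; congr (_, _).
apply/setP => x; rewrite !inE; case: eqP => [->|_] //=.
by rewrite (negbTE ur) addbF.
Qed.

Lemma dualityE n (i j : 'I_n) K : sym i j K \in symbols n ->
  duality n (sym i j K) = sym i j (~: (K :|: [set i; j])).
Proof.
rewrite inE /= => /andP[_ dK].
rewrite /duality prod_flipE ?index_enum_uniq //=; congr (_, _).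
apply/setP => x; rewrite !inE mem_index_enum /=.
have := disjointFr dK (x := x); rewrite !inE.
by case: (_ || _) => [->|] //=; case: (x \in K).
Qed.

Lemma flip_group_fst n (g : {perm symbol n}) a :
  g \in flip_group n -> (g a).1 = a.1.
Proof.
move=> /gen_prodgP[m [c c_flip ->]].
elim/big_rec: _ a => [|i x _ IHx] a; first by rewrite perm1.
by rewrite permM IHx; case/imsetP: (c_flip i) => u _ ->; rewrite flipE.
Qed.

Lemma flip_relabel n (u : 'I_n) s : flip u ^ relabel s = flip (s u).
Proof.
apply/permP => a; rewrite conjgE !permM -[a in RHS](permKV (relabel s)).
set b := _ a; rewrite !flipE !permE /relabel_fun /=; congr (_, _).
apply/setP => x; rewrite -(permKV s x); move: (s^-1 x) => y.
by rewrite !inE !(mem_imset _ _ (@perm_inj _ s)) (inj_eq (@perm_inj _ s)) inE.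
Qed.

Lemma flip_relabel_TI n : flip_group n :&: relabel_group n = 1.
Proof.
apply/trivgP/subsetP => g; rewrite inE relabel_groupE.
case/andP=> gF /imsetP[s _ def_g].
suff s1 x : s x = x.
  rewrite inE def_g; apply/eqP/permP => -[P K].
  rewrite perm1 permE /relabel_fun /=.
  by rewrite !(eq_imset _ s1) !imset_id.
have := flip_group_fst ([set x], set0) gF.
by rewrite def_g permE /= imset_set1 => /set1_inj.
Qed.

Lemma flip_relabel_norm n : relabel_group n \subset 'N(flip_group n).
Proof.
rewrite relabel_groupE; apply/subsetP => _ /imsetP[s _ ->].
rewrite inE -genJ gen_subG; apply/subsetP => _ /imsetP[_ /imsetP[u _ ->] ->].
by rewrite flip_relabel mem_gen ?imset_f.
Qed.

Lemma hyperoctahedral_group_sdprod n :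
  flip_group n ><| relabel_group n = hyperoctahedral_group n.
Proof. by rewrite sdprodEY ?flip_relabel_norm ?flip_relabel_TI. Qed.

Lemma duality_flip n : duality n \in flip_group n.
Proof. by apply: group_prod => u _; rewrite mem_gen ?imset_f. Qed.

Lemma duality_relabel n s : duality n ^ relabel s = duality n.
Proof.
apply/permP => a; rewrite conjgE !permM -[a in RHS](permKV (relabel s)).
set b := _ a; rewrite /duality !prod_flipE ?index_enum_uniq //.
rewrite !permE /relabel_fun /=.
congr (_, _); apply/setP => x; rewrite -(permKV s x); move: (s^-1 x) => y.
by rewrite !inE !(mem_imset _ _ (@perm_inj _ s)) inE !mem_index_enum.
Qed.

Lemma twisted_group_sdprod n :
  <[duality n]> ><| relabel_group n = twisted_group n.
Proof.
rewrite sdprodEY //.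
  rewrite relabel_groupE; apply/subsetP => _ /imsetP[s _ ->].
  by rewrite inE -cycleJ duality_relabel.
apply/trivgP; rewrite -(flip_relabel_TI n) setSI // cycle_subG.
exact: duality_flip.
Qed.

(* Main.v *)
Require Import Defs.
From Corelib Require Import BinNums PosDef.
From mathcomp Require Import all_boot all_fingroup.

(** A symbol a_{ij|K} is a 2-face of the n-cube; it is coded by the word of
length n over 0, 1 and a star that has stars at i and j and ones on K. Each
gaussoid axiom compares 2-faces of a single 3-face, so being a gaussoid is a
condition on each 3-face. Taken over all orders of i, j, k, the axioms become
symmetric: if d_1, d_2, d_3 count the members of the gaussoid in the three
pairs of parallel 2-faces of a 3-face, then either one of the d is 1 and the
other two are 0, or no d is 1 and their sum is not 2 ([gaussoidE]). This
condition depends neither on the order of the coordinates nor on the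
orientation of the pairs, so every symmetry of the cube permutes the gaussoids
([gaussoids_sperm]).

By the Cauchy-Frobenius lemma ([orbit_count]), it remains to count the
gaussoids fixed by each signed permutation. This number only depends on the
conjugacy class in the hyperoctahedral group ([card_fixed_conj]), also for the
elements of the two smaller groups. Writing a signed permutation cycle by cycle
conjugates it to a normal form, and there are 36 normal forms for n = 5. The
gaussoids fixed by g are the labellings of the g-orbits of 2-faces by booleans
that satisfy one constraint, on at most six labels, for each 3-face
([card_fixed], [fix_countE]).

These labellings are counted by the transfer matrix method ([count_modelsE]).
The labels are chosen one at a time. What matters of a partial labelling is, for
each constraint that involves both chosen and unchosen labels, the set of
completions that it still allows. Partial labellings that agree in this respect
are merged into one state, with a weight that counts them, and the weighted
states are stored in a trie. The 2-faces are read by increasing largest vertex,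
so that a subcube is complete before the next coordinate is opened and few
constraints are open at the same time. This merges the millions of partial
labellings of the case n = 5, g = 1 into hundreds of thousands of states. *)

Set Implicit Arguments.
Unset Strict Implicit.
Unset Printing Implicit Defensive.

(** * Counting the solutions of a list of local constraints *)

Fixpoint words n : seq bitseq :=
  if n is n'.+1 then map (cons false) (words n') ++ map (cons true) (words n')
  else [:: [::]].

Lemma mem_words n w : (w \in words n) = (size w == n).
Proof.
elim: n w => [|n IHn] [|b w] //=; rewrite mem_cat.
  by apply/orP => -[] /mapP[].
rewrite eqSS -IHn.
have consI c : injective (cons c : bitseq -> _) by move=> ? ? [].
case: b; rewrite mem_map // ?orbF; last by rewrite orbC; case: mapP => // -[].
by case: mapP => // -[].
Qed.

Lemma words_uniq n : uniq (words n).
Proof.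
have consI c : injective (cons c : bitseq -> _) by move=> ? ? [].
elim: n => //= n IHn; rewrite cat_uniq !map_inj_uniq // IHn andbT /=.
by apply/hasPn => _ /mapP[w _ ->]; apply/mapP => -[].
Qed.

Lemma count_words n (p : pred bitseq) :
  count p (words n.+1) =
    count (p \o cons false) (words n) + count (p \o cons true) (words n).
Proof. by rewrite /= count_cat !count_map. Qed.

(** A finite weighted set of sequences of numbers. [Branch i t1 t2] puts [i] in
front of the sequences of [t1] and adds those of [t2]: the children of a node
form a linked list, whose nodes are tries themselves. *)
Inductive wtrie := Void | Weight of positive | Branch of nat & wtrie & wtrie.

(** The operations on tries are specified by this pairing alone, for all [k], so
that no invariant on the shape of a trie has to be stated. *)
Fixpoint value (k : seq nat -> nat) t : nat :=
  match t with
  | Void => 0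
  | Weight c => nat_of_pos c * k [::]
  | Branch i t1 t2 => value (fun v => k (i :: v)) t1 + value k t2
  end.

Fixpoint add_weight c t :=
  match t with
  | Void => Weight c
  | Weight d => Weight (Pos.add c d)
  | Branch i t1 t2 => Branch i t1 (add_weight c t2)
  end.

(** Here [f] is the union with [s]; with [f] as an argument, [union] is
structurally recursive. *)
Fixpoint graft i s (f : wtrie -> wtrie) t :=
  match t with
  | Branch j t1 t2 =>
    if eqn i j then Branch j (f t1) t2 else Branch j t1 (graft i s f t2)
  | _ => Branch i s t
  end.

Fixpoint union t u :=
  match t with
  | Void => u
  | Weight c => add_weight c u
  | Branch i t1 t2 => graft i t1 (union t1) (union t2 u)
  end.

(** The effect of a letter on an open constraint: none, a change of state, or a
last check, after which the constraint is dropped. The tables send a state to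
the next one, or to [None] if the constraint fails. *)
Inductive op := Skip | Move of seq (option nat) | Close of seq (option nat).

Definition branch i t1 t2 := if t1 is Void then t2 else Branch i t1 t2.

Fixpoint advance ops t {struct t} :=
  match t with
  | Void => Void
  | Weight c => if ops is [::] then t else Void
  | Branch i t1 t2 =>
    match ops with
    | [::] => advance ops t2
    | Skip :: ops' => branch i (advance ops' t1) (advance ops t2)
    | Move tab :: ops' =>
      if nth None tab i is Some j then
        match advance ops' t1 with
        | Void => advance ops t2
        | t1' => graft j t1' (union t1') (advance ops t2)
        end
      else advance ops t2
    | Close tab :: ops' =>
      if nth None tab i is Some _ then union (advance ops' t1) (advance ops t2)
      else advance ops t2
    end
  end.

Fixpoint step ops v : option (seq nat) :=
  match ops, v with
  | [::], [::] => Some [::]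
  | Skip :: ops', i :: v' => omap (cons i) (step ops' v')
  | Move tab :: ops', i :: v' =>
    if nth None tab i is Some j then omap (cons j) (step ops' v') else None
  | Close tab :: ops', i :: v' =>
    if nth None tab i is Some _ then step ops' v' else None
  | _, _ => None
  end.

Lemma eq_value k1 k2 t : k1 =1 k2 -> value k1 t = value k2 t.
Proof.
elim: t k1 k2 => //= [c|i t1 IH1 t2 IH2] k1 k2 e; first by rewrite e.
by rewrite (IH1 _ (fun v => k2 (i :: v))) ?(IH2 _ k2).
Qed.

Lemma valueD k1 k2 t :
  value (fun v => k1 v + k2 v) t = value k1 t + value k2 t.
Proof.
elim: t k1 k2 => //= [c|i t1 IH1 t2 IH2] k1 k2; first by rewrite mulnDr.
by rewrite IH1 IH2 addnACA.
Qed.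

Lemma value0 t : value (fun=> 0) t = 0.
Proof. by elim: t => //= [c|i t1 -> t2 ->]; rewrite ?muln0. Qed.

Lemma value_add_weight k c t :
  value k (add_weight c t) = nat_of_pos c * k [::] + value k t.
Proof.
elim: t => /= [|d|i t1 _ t2 ->]; first by rewrite addn0.
  by rewrite -mulnDl -nat_of_add_pos.
exact: addnCA.
Qed.

Lemma value_graft k i s f t :
    (forall k' t', value k' (f t') = value k' s + value k' t') ->
  value k (graft i s f t) = value (fun v => k (i :: v)) s + value k t.
Proof.
move=> fE; elim: t => //= j t1 _ t2 IHt.
case: eqnP => [->|_] /=; first by rewrite fE addnA.
by rewrite IHt addnCA.
Qed.

Lemma value_union k t u : value k (union t u) = value k t + value k u.
Proof.
elim: t k u => //= [c|i t1 IH1 t2 IH2] k u; first exact: value_add_weight.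
by rewrite value_graft ?IH2 ?addnA.
Qed.

Lemma value_branch k i t1 t2 :
  value k (branch i t1 t2) = value (fun v => k (i :: v)) t1 + value k t2.
Proof. by case: t1. Qed.

(** Merging states is sound because [value] is additive: [advance] is the image of
the weighted set under the partial function [step]. *)
Lemma value_advance k ops t :
  value k (advance ops t) = value (fun v => oapp k 0 (step ops v)) t.
Proof.
elim: t k ops => //= [c|i t1 IH1 t2 IH2] k ops.
  by case: ops => [|[|tab|tab] ops] /=; rewrite ?muln0.
case: ops => [|[|tab|tab] ops] /=; first by rewrite value0 IH2.
- rewrite value_branch IH1 IH2; congr (_ + _).
  by apply: eq_value => v; case: (step ops v).
- rewrite -(IH2 k (Move tab :: ops)).
  case: (nth None tab i) => [j|]; last by rewrite value0.
  transitivity (value (fun v => k (j :: v)) (advance ops t1) +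
                value k (advance (Move tab :: ops) t2)).
    have graftE u w : value k (graft j u (union u) w) =
      value (fun v => k (j :: v)) u + value k w.
      by apply: value_graft => k' t'; apply: value_union.
    by case: (advance ops t1) => [|c|i' t1' t2']; rewrite ?graftE.
  by rewrite IH1; congr (_ + _); apply: eq_value => v; case: (step ops v).
- rewrite -(IH2 k (Close tab :: ops)).
  case: (nth None tab i) => [j|]; last by rewrite value0.
  by rewrite value_union IH1.
Qed.

Definition residual b (L : seq bitseq) : seq bitseq :=
  [seq behead w | w <- L & ohead w == Some b].

Lemma mem_residual b L w : (w \in residual b L) = (b :: w \in L).
Proof.
apply/mapP/idP => [[u]|wL]; last by exists (b :: w); rewrite // mem_filter eqxx.
by rewrite mem_filter; case: u => //= c u /andP[/eqP[->] uL] ->.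
Qed.

(** An open constraint consists of the mask of the variables that it involves
among those still to be read, and of the list of languages that may be left for
their values. A state is an index into this list, and out of the list it stands
for the empty language. *)
Definition next_states (S : seq (seq bitseq)) :=
  undup [seq L <- map (residual false) S ++ map (residual true) S | ~~ nilp L].

Definition op_of b (a : bitseq * seq (seq bitseq)) : op :=
  if ~~ head false a.1 then Skip
  else if has id (behead a.1) then
    let S' := next_states a.2 in
    Move [seq let L' := residual b L in
              if nilp L' then None else Some (index L' S') | L <- a.2]
  else
    Close [seq if [::] \in residual b L then Some 0 else None | L <- a.2].

Definition next_active (A : seq (bitseq * seq (seq bitseq))) :=
  [seq a <- [seq (behead a.1, if head false a.1 then next_states a.2 else a.2)
            | a <- A] | has id a.1].

Fixpoint accepts (A : seq (bitseq * seq (seq bitseq))) v c : bool :=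
  match A, v with
  | [::], [::] => true
  | a :: A', i :: v' => (mask a.1 c \in nth [::] a.2 i) && accepts A' v' c
  | _, _ => false
  end.

Lemma mask_nhas (T : Type) m (s : seq T) : ~~ has id m -> mask m s = [::].
Proof. by elim: m s => [|[] m IHm] [|x s] //=; apply: IHm. Qed.

(** Reading [b] replaces the languages of the constraints that involve the current
variable by their residuals; a constraint without further variables is left with
the question whether its residual contains the empty word. *)
Lemma accepts_step n A v b c :
    all (fun a => (size a.1 == n.+1) && has id a.1) A ->
  accepts A v (b :: c) =
    oapp (fun v' => accepts (next_active A) v' c) false
      (step (map (op_of b) A) v).
Proof.
elim: A v => [|[m S] A IHA] [|i v] //=; first by case: (op_of _ _).
case: m => [|[] m] //= /andP[/andP[_ mT] /IHA{}IHA].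
  rewrite {1}/op_of /=; case: ifP => m_has /=; last first.
    rewrite mask_nhas ?m_has // IHA /next_active /= m_has.
    have [iS|iS] := ltnP i (size S); last first.
      by rewrite !nth_default ?size_map.
    rewrite (nth_map [::]) // mem_residual.
    by case: ([:: b] \in _).
  rewrite IHA /next_active /= m_has -mem_residual.
  have [iS|iS] := ltnP i (size S); last first.
    by rewrite !nth_default ?size_map.
  rewrite (nth_map [::]) //=; set L := residual b _.
  case: ifPn => [/nilP-> | L_gt0] //=.
  have LS : L \in next_states S.
    rewrite mem_undup mem_filter L_gt0 mem_cat.
    have SL : nth [::] S i \in S by rewrite mem_nth.
    by rewrite /L; case: (b); rewrite map_f ?orbT.
  case: (step _ v) => [v'|] /=; last by rewrite andbF.
  by rewrite nth_index.
rewrite IHA {1}/op_of /next_active /= mT.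
by case: (step _ v) => [v'|] //=; rewrite andbF.
Qed.

Fixpoint top_weight t : N :=
  match t with
  | Void => N0
  | Weight c => Npos c
  | Branch _ _ t2 => top_weight t2
  end.

Lemma value_top t : value (fun v => nilp v) t = top_weight t.
Proof. by elim: t => //= [c|i t1 _ t2 ->]; rewrite ?muln1 ?value0. Qed.

(** Always true. Its evaluation forces the whole trie, so that under lazy
evaluation the tries of the previous steps do not stay alive in suspended
computations. *)
Fixpoint settled t : bool :=
  match t with
  | Void => true
  | Weight c => if c is xH then true else true
  | Branch _ t1 t2 => settled t1 && settled t2
  end.

Lemma settledT t : settled t.
Proof. by elim: t => [|[]|i t1 IH1 t2 IH2] //=; rewrite IH1. Qed.

(** The tables depend on the constraints only. They are separated from the sweep,
so that their own suspended computations refer to no trie. *)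
Fixpoint schedule n (P : seq (bitseq * seq bitseq)) A :
    seq (nat * (seq op * seq op)) :=
  if n is n'.+1 then
    let new := [seq p <- P | head false p.1] in
    let old := [seq (behead p.1, p.2) | p <- P & ~~ head false p.1] in
    let A' := [seq (p.1, [:: p.2]) | p <- new] ++ A in
    (size new, (map (op_of false) A', map (op_of true) A'))
      :: schedule n' old (next_active A')
  else [::].

Fixpoint sweep (l : seq (nat * (seq op * seq op))) t : N :=
  if settled t then
    if l is (d, (ops0, ops1)) :: l' then
      let t' := iter d (fun u => Branch 0 u Void) t in
      sweep l' (union (advance ops0 t') (advance ops1 t'))
    else top_weight t
  else N0.

Definition satisfies (P : seq (bitseq * seq bitseq)) c :=
  all (fun p => mask p.1 c \in p.2) P.

Definition wf n (P : seq (bitseq * seq bitseq)) :=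
  all (fun p => (size p.1 == n) && has id p.1) P.

Lemma value_start k d t :
  value k (iter d (fun u => Branch 0 u Void) t) =
    value (fun v => k (nseq d 0 ++ v)) t.
Proof.
elim: d k => [|d IHd] k /=; first exact: eq_value.
by rewrite addn0 IHd.
Qed.

Lemma accepts_start new A v c :
  accepts ([seq (p.1, [:: p.2]) | p <- new] ++ A) (nseq (size new) 0 ++ v) c =
    satisfies new c && accepts A v c.
Proof. by elim: new => //= p new ->; rewrite andbA. Qed.

(** The weight of a state is the number of prefixes that lead to it; pairing it
with the number of accepted suffixes gives a quantity that no step of the sweep
changes. *)
Lemma sweepE n P A t :
    wf n P -> all (fun a => (size a.1 == n) && has id a.1) A ->
  sweep (schedule n P A) t =
    value (fun v => count (fun c => satisfies P c && accepts A v c) (words n)) t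
    :> nat.
Proof.
elim: n P A t => [|n IHn] P A t wfP wfA.
  have -> : P = [::] by case: P wfP => //= -[[|? ?] ?].
  have -> : A = [::] by case: A wfA => //= -[[|? ?] ?].
  rewrite /= settledT -value_top; apply: eq_value => v.
  by case: v.
rewrite /= settledT; set new := [seq p <- P | head false p.1].
set old := [seq _ | p <- P & _].
set A' := _ ++ A.
have wfA' : all (fun a => (size a.1 == n.+1) && has id a.1) A'.
  rewrite all_cat wfA andbT all_map /new all_filter.
  by apply: sub_all wfP => p /= ->; rewrite implybT.
have wf_old : wf n old.
  rewrite /wf /old all_map all_filter; apply: sub_all wfP => -[[|[] m] L] //=.
have wf_next : all (fun a => (size a.1 == n) && has id a.1) (next_active A').
  rewrite /next_active all_filter all_map; apply: sub_all wfA' => -[m S] /=.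
  by case: m => //= x m /andP[/eqP[->] _]; rewrite eqxx implybb.
rewrite IHn // value_union !value_advance !value_start -valueD.
apply: eq_value => v; rewrite -/(words n.+1) count_words.
have sat_split b c :
    satisfies P (b :: c) = satisfies new (b :: c) && satisfies old c.
  rewrite /satisfies /new /old; elim: (P) wfP => //= -[[|[] m] L] Q IH //=.
    by move=> /andP[_ /IH->] /=; rewrite andbA.
  by move=> /andP[_ /IH->] /=; rewrite andbCA.
have half b : oapp (fun v' => count (fun c => satisfies old c &&
      accepts (next_active A') v' c) (words n)) 0
      (step (map (op_of b) A') (nseq (size new) 0 ++ v)) =
    count ((fun c => satisfies P c && accepts A v c) \o cons b) (words n).
  under [RHS]eq_count => c.
    rewrite /= sat_split andbC andbA [_ && satisfies new _]andbC -accepts_start.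
    rewrite (accepts_step _ _ _ wfA') andbC; over.
  case: (step _ _) => [v'|] //=.
  by under eq_count => c do rewrite andbF; rewrite count_pred0.
by rewrite !half.
Qed.

Definition count_models n P : N := sweep (schedule n P [::]) (Weight xH).

Lemma count_modelsE n P :
  wf n P -> count_models n P = count (satisfies P) (words n) :> nat.
Proof.
move=> wfP; rewrite /count_models sweepE //= mul1n.
by apply: eq_count => c; rewrite andbT.
Qed.

(** * Gaussoids as locally constrained sets of 2-faces of the cube *)

(** Faces of the cube: [None] marks a free coordinate, [Some b] a fixed one. *)
Definition cell := seq (option bool).

(** The faces of dimension [k] with largest vertex [m]. *)
Fixpoint stars k (m : bitseq) : seq cell :=
  if m is b :: m' then
    (if b && (0 < k) then map (cons None) (stars k.-1 m') else [::])
      ++ map (cons (Some b)) (stars k m')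
  else if k is 0 then [:: [::]] else [::].

Definition top_vertex (w : cell) : bitseq := map (odflt true) w.

Lemma mem_stars k m w :
  (w \in stars k m) = (top_vertex w == m) && (count_mem None w == k).
Proof.
elim: m k w => [|b m IHm] k [|x w] /=.
- by case: k.
- by case: k.
- by rewrite mem_cat; apply/orP => -[]; [case: ifP => // _ | ]; case/mapP.
have consI c : injective (cons c : cell -> cell) by move=> ? ? [].
rewrite mem_cat eqseq_cons; case: x => [c|] /=.
  rewrite (_ : (_ \in _) = false) /=; last first.
    by case: ifP => // _; apply/mapP => -[].
  have [<-|cb] /= := eqVneq c b; first by rewrite mem_map // IHm add0n.
  by apply/mapP => -[u _ [/eqP]]; rewrite (negPf cb).
rewrite [X in _ || X](_ : _ = false) ?orbF; last by apply/mapP => -[].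
case: b => //=; case: k => [|k] /=; first by rewrite add1n andbF.
by rewrite mem_map // IHm add1n eqSS.
Qed.

Lemma stars_uniq k m : uniq (stars k m).
Proof.
have consI c : injective (cons c : cell -> cell) by move=> ? ? [].
elim: m k => [|b m IHm] k /=; first by case: k.
rewrite cat_uniq (map_inj_uniq (consI (Some b))) IHm andbT.
case: ifP => /= _; last by apply/hasPn.
rewrite map_inj_uniq // IHm; apply/hasPn => _ /mapP[u _ ->].
by apply/mapP => -[].
Qed.

(** This order, by largest vertex, is the one in which the sweep reads the
2-faces; reading them in an unsuitable order multiplies the number of states. *)
Definition cells n k : seq cell := flatten [seq stars k m | m <- words n].

Lemma mem_cells n k w :
  (w \in cells n k) = (size w == n) && (count_mem None w == k).
Proof.
apply/flatten_mapP/andP => [[m] | [sz_w k_w]].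
  by rewrite mem_words mem_stars => /eqP <- /andP[/eqP <-]; rewrite size_map.
exists (top_vertex w); first by rewrite mem_words size_map.
by rewrite mem_stars eqxx.
Qed.

Lemma cells_uniq n k : uniq (cells n k).
Proof.
rewrite /cells; elim: (words n) (words_uniq n) => //= m r IHr /andP[mr r_uniq].
rewrite cat_uniq stars_uniq IHr // andbT /=.
apply/hasPn => w /flatten_mapP[m' m'r]; rewrite !mem_stars.
move=> /andP[/eqP def_m' _].
by apply: contra mr => /andP[/eqP <- _]; rewrite def_m'.
Qed.

Definition free (w : cell) :=
  [seq i <- iota 0 (size w) | nth (Some false) w i == None].

Definition facet (w : cell) i b : cell := set_nth (Some false) w i (Some b).

Definition facets w := [seq (facet w i false, facet w i true) | i <- free w].

(** [d] lists the numbers of chosen 2-faces in the pairs of parallel 2-faces of a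
3-face. Of the 64 subsets of the 2-faces, 11 are admissible: the empty and the
full one, the six singletons, and the three unions of two pairs. *)
Definition admissible (d : seq nat) :=
  if 1 \in d then sumn d == 1 else sumn d != 2.

Definition decode n (w : cell) : symbol n :=
  ([set i : 'I_n | nth (Some false) w i == None],
   [set i : 'I_n | nth (Some false) w i == Some true]).

Definition encode n (a : symbol n) : cell :=
  [seq if i \in a.1 then None else Some (i \in a.2) | i <- enum 'I_n].

Lemma size_encode n (a : symbol n) : size (encode a) = n.
Proof. by rewrite size_map size_enum_ord. Qed.

Lemma nth_encode n (a : symbol n) (i : 'I_n) x :
  nth x (encode a) i = if i \in a.1 then None else Some (i \in a.2).
Proof. by rewrite (nth_map i) ?size_enum_ord // nth_ord_enum. Qed.

Lemma encodeK n (a : symbol n) :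
  [disjoint a.1 & a.2] -> decode n (encode a) = a.
Proof.
case: a => P K /= dPK; congr (_, _); apply/setP => i; rewrite inE nth_encode /=.
  by case: (i \in P).
by case: ifPn => [/(disjointFr dPK)->|_] //=; case: (i \in K).
Qed.

Lemma decodeK n w : size w = n -> encode (decode n w) = w.
Proof.
move=> sz_w; apply: (@eq_from_nth _ (Some false)) => [|i].
  by rewrite size_encode sz_w.
rewrite size_encode => lt_in; rewrite (nth_encode _ (Ordinal lt_in)) !inE /=.
by case: (nth _ w i) => [[]|].
Qed.

Lemma decode_disjoint n w : [disjoint (decode n w).1 & (decode n w).2].
Proof.
by rewrite -setI_eq0; apply/eqP/setP => i; rewrite !inE; case: (nth _ w i).
Qed.

Lemma card_decode n w : size w = n -> #|(decode n w).1| = count_mem None w.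
Proof.
move=> sz_w; rewrite -{2}(decodeK sz_w) /encode count_map.
rewrite -sum1_count big_enum_cond -sum1_card; apply: eq_bigl => i /=.
by case: (i \in _).
Qed.

Lemma mem_symbols n w :
  size w = n -> (decode n w \in symbols n) = (w \in cells n 2).
Proof.
move=> sz_w.
by rewrite inE decode_disjoint andbT card_decode // mem_cells sz_w eqxx.
Qed.

Lemma encode_cells n (a : symbol n) : a \in symbols n -> encode a \in cells n 2.
Proof.
move=> a_sym; rewrite -mem_symbols ?size_encode // encodeK //.
by move: a_sym; rewrite inE => /andP[].
Qed.

Lemma mem_free n w (i : 'I_n) :
  size w = n -> (val i \in free w) = (i \in (decode n w).1).
Proof.
by move=> sz_w; rewrite mem_filter mem_iota add0n sz_w /= ltn_ord inE andbT.
Qed.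

Lemma free_uniq w : uniq (free w).
Proof. by rewrite filter_uniq ?iota_uniq. Qed.

Lemma size_free w : size (free w) = count_mem None w.
Proof.
rewrite size_filter -[w in RHS](mkseq_nth (Some false)) count_map.
exact: eq_count.
Qed.

Lemma perm_free n w (s : seq 'I_n) :
    size w = n -> uniq s -> (decode n w).1 = [set i in s] ->
  perm_eq (map val s) (free w).
Proof.
move=> sz_w s_uniq Ds.
apply: uniq_perm; rewrite ?free_uniq ?(map_inj_uniq val_inj) //.
move=> i; apply/mapP/idP => [[j js ->]|]; first by rewrite mem_free // Ds inE.
move=> i_free; have lt_in: i < n.
  by move: i_free; rewrite mem_filter mem_iota sz_w => /andP[].
exists (Ordinal lt_in) => //; move: i_free.
by rewrite (mem_free (Ordinal lt_in)) // Ds inE.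
Qed.

Lemma decode_facet n w (i j k : 'I_n) b :
    size w = n -> uniq [:: i; j; k] ->
    (decode n w).1 = [set x in [:: i; j; k]] ->
  decode n (facet w k b) =
    sym i j (if b then k |: (decode n w).2 else (decode n w).2).
Proof.
move=> sz_w /= /and3P[i_jk j_k _] Dw.
have wk : nth (Some false) w k = None.
  by move/setP/(_ k): Dw; rewrite !inE eqxx !orbT => /eqP.
rewrite /sym /decode /facet; congr (_, _); apply/setP => x; last first.
  have [-> | xk] := eqVneq x k.
    by rewrite !inE nth_set_nth /= eqxx; case: b; rewrite !inE ?eqxx ?wk.
  by case: b; rewrite !inE nth_set_nth /= (inj_eq val_inj) (negPf xk).
move/setP/(_ x): Dw; rewrite !inE nth_set_nth /= (inj_eq val_inj).
have [-> | xk] := eqVneq x k; last by rewrite orbF.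
move: i_jk j_k; rewrite !inE negb_or ![k == _]eq_sym.
by move=> /andP[_ /negPf->] /negPf->.
Qed.

Section Pattern.
Variables (n : nat) (G : {set symbol n}).
Let mult w i : nat :=
  (decode n (facet w i false) \in G) + (decode n (facet w i true) \in G).

(** Up to the symmetry of symbols, the axioms for the six orders of [i], [j], [k]
are conditions on the same six memberships. *)
Lemma G1_4E w (i j k : 'I_n) (L := (decode n w).2) :
    size w = n -> uniq [:: i; j; k] ->
    (decode n w).1 = [set x in [:: i; j; k]] ->
  admissible [:: mult w i; mult w j; mult w k] =
    [&& [&& G1 G i j k L, G2 G i j k L, G3 G i j k L & G4 G i j k L],
        [&& G1 G i k j L, G2 G i k j L, G3 G i k j L & G4 G i k j L],
        [&& G1 G j i k L, G2 G j i k L, G3 G j i k L & G4 G j i k L],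
        [&& G1 G j k i L, G2 G j k i L, G3 G j k i L & G4 G j k i L],
        [&& G1 G k i j L, G2 G k i j L, G3 G k i j L & G4 G k i j L]
      & [&& G1 G k j i L, G2 G k j i L, G3 G k j i L & G4 G k j i L]].
Proof.
move=> sz_w ijk Dw; rewrite /mult.
have symC a b K : sym a b K = sym b a K :> symbol n by rewrite /sym setUC.
rewrite !(decode_facet _ sz_w ijk Dw).
have ikj : uniq [:: i; k; j].
  rewrite (perm_uniq (_ : perm_eq _ [:: i; j; k])) //.
  by rewrite perm_cons (perm_catC [:: k]).
have jki : uniq [:: j; k; i] by rewrite -(rot_uniq 2).
have Dikj : (decode n w).1 = [set x in [:: i; k; j]].
  by rewrite Dw; apply/setP => x; rewrite !inE [(x == j) || _]orbC.
have Djki : (decode n w).1 = [set x in [:: j; k; i]].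
  by rewrite Dw; apply/setP => x; rewrite !inE orbC orbA.
rewrite !(decode_facet _ sz_w ikj Dikj) !(decode_facet _ sz_w jki Djki) -/L.
rewrite /G1 /G2 /G3 /G4 !(symC j i) !(symC k i) !(symC k j).
move: (sym j k L \in G) (sym j k (i |: L) \in G) (sym i k L \in G).
move: (sym i k (j |: L) \in G) (sym i j L \in G) (sym i j (k |: L) \in G).
by case=> [] [] [] [] [] [].
Qed.

Lemma perm_admissible d1 d2 : perm_eq d1 d2 -> admissible d1 = admissible d2.
Proof. by move=> pd; rewrite /admissible (perm_mem pd) (perm_sumn pd). Qed.

(** A 3-face determines its free coordinates [i], [j], [k] up to order and the set
[L], and conversely; the order is irrelevant since [admissible] only depends on
the multiset of its argument. *)
Lemma gaussoidE :
  gaussoid G = (G \subset symbols n) &&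
    all (fun w => admissible [seq mult w i | i <- free w]) (cells n 3).
Proof.
rewrite /gaussoid; congr (_ && _); apply/forallP/allP => [ax w | loc i].
  rewrite mem_cells => /andP[/eqP sz_w /eqP w3].
  have := card_decode sz_w; rewrite w3 => /eqP; rewrite cardE.
  set s := enum _ => sz_s; have s_uniq : uniq s by rewrite enum_uniq.
  have Dw : (decode n w).1 = [set x in s].
    by apply/setP => x; rewrite inE mem_enum.
  rewrite -(perm_admissible (perm_map _ (perm_free sz_w s_uniq Dw))) -map_comp.
  have dL := decode_disjoint n w; rewrite Dw in dL.
  case: s sz_s s_uniq Dw dL => [|i [|j [|k []]]] // _ ijk Dw dL.
  rewrite /= G1_4E //.
  have {}ax i' j' k' : perm_eq [:: i'; j'; k'] [:: i; j; k] ->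
     [&& G1 G i' j' k' (decode n w).2, G2 G i' j' k' (decode n w).2,
         G3 G i' j' k' (decode n w).2 & G4 G i' j' k' (decode n w).2].
    move=> p; have /forallP/(_ j')/forallP/(_ k') := ax i'.
    move=> /forallP/(_ (decode n w).2).
    rewrite (perm_uniq p) ijk /= => /implyP; apply.
    apply: etrans dL; apply: eq_disjoint => x.
    by rewrite !inE -orbA; have := perm_mem p x; rewrite !inE.
  rewrite !ax //; apply/seq.permP => a /=; rewrite !addn0.
  - by rewrite addnC [X in X + _]addnC addnA.
  - by rewrite addnC addnA.
  - by rewrite addnA addnC.
  - exact: addnCA.
  - by rewrite [X in _ + X]addnC.
apply/forallP => j; apply/forallP => k; apply/forallP => L; apply/implyP.
case/andP => ijk dL; pose w := encode ([set i; j; k], L).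
have Dw : decode n w = ([set i; j; k], L) by rewrite encodeK.
have sz_w : size w = n by rewrite size_encode.
have Dw1 : (decode n w).1 = [set x in [:: i; j; k]].
  by rewrite Dw; apply/setP => x; rewrite !inE orbA.
have w_cell : w \in cells n 3.
  rewrite mem_cells sz_w eqxx -(card_decode sz_w) Dw1 cardsE.
  by have /card_uniqP -> := ijk.
have := loc w w_cell.
rewrite -(perm_admissible (perm_map _ (perm_free sz_w ijk Dw1))) -map_comp /=.
by rewrite G1_4E // Dw /= => /andP[].
Qed.

End Pattern.

(** * Signed permutations *)

(** A signed permutation is coded by its list of pairs: if the entry at [i] is
[(p, e)], then coordinate [i] of the image is coordinate [p] of the argument,
complemented if [e]. *)
Notation signed_seq := (seq (nat * bool)).

Definition act_cell (x : signed_seq) (w : cell) : cell :=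
  [seq omap (addb p.2) (nth (Some false) w p.1) | p <- x].

Definition signed_perm n (x : signed_seq) := perm_eq (unzip1 x) (iota 0 n).

Lemma size_signed_perm n x : signed_perm n x -> size x = n.
Proof. by move/perm_size; rewrite size_map size_iota. Qed.

Lemma signed_perm_lt n x i :
  signed_perm n x -> i < n -> (nth (0, false) x i).1 < n.
Proof.
move=> xP lt_in; have /perm_mem/(_ (nth (0, false) x i).1) := xP.
rewrite mem_iota add0n => /= <-.
by rewrite map_f ?mem_nth ?(size_signed_perm xP).
Qed.

Lemma size_act x w : size (act_cell x w) = size x.
Proof. exact: size_map. Qed.

Lemma nth_act n x w i : signed_perm n x -> i < n ->
  nth (Some false) (act_cell x w) i =
    omap (addb (nth (0, false) x i).2)
         (nth (Some false) w (nth (0, false) x i).1).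
Proof.
by move=> xP lt_in; rewrite (nth_map (0, false)) ?(size_signed_perm xP).
Qed.

Lemma perm_free_act n x w : signed_perm n x -> size w = n ->
  perm_eq [seq (nth (0, false) x i).1 | i <- free (act_cell x w)] (free w).
Proof.
move=> xP sz_w; rewrite /free size_act (size_signed_perm xP) sz_w.
have defx : [seq (nth (0, false) x i).1 | i <- iota 0 n] = unzip1 x.
  rewrite -[x in RHS](mkseq_nth (0, false)) (size_signed_perm xP).
  by rewrite /unzip1 -map_comp.
rewrite (_ : [seq i <- iota 0 n | _ == None] =
  filter (preim (fun i => (nth (0, false) x i).1)
     (fun j => nth (Some false) w j == None)) (iota 0 n)); last first.
  apply: eq_in_filter => i; rewrite mem_iota => /= lt_in.
  by rewrite (nth_act _ xP) //; case: (nth _ w _).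
by rewrite -filter_map defx perm_filter.
Qed.

Lemma act_facet n x w i b : signed_perm n x -> size w = n -> i < n ->
  act_cell x (facet w (nth (0, false) x i).1 b) =
    facet (act_cell x w) i (b (+) (nth (0, false) x i).2).
Proof.
move=> xP sz_w lt_in; apply: (@eq_from_nth _ (Some false)).
  by rewrite size_set_nth !size_act (size_signed_perm xP) (maxn_idPr _).
move=> j; rewrite size_act (size_signed_perm xP) => lt_jn.
rewrite nth_set_nth /= !(nth_act _ xP) // nth_set_nth /=.
have x_inj : ((nth (0, false) x j).1 == (nth (0, false) x i).1) = (j == i).
  have x_uniq : uniq (unzip1 x) by rewrite (perm_uniq xP) iota_uniq.
  have sz_x := size_signed_perm xP.
  by rewrite -!(nth_map _ 0) ?sz_x // nth_uniq // size_map sz_x.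
by rewrite x_inj; case: eqP => //= ->; rewrite addbC.
Qed.

Lemma act_cells n k x w :
  signed_perm n x -> w \in cells n k -> act_cell x w \in cells n k.
Proof.
move=> xP; rewrite !mem_cells size_act (size_signed_perm xP) eqxx -!size_free.
case/andP=> /eqP sz_w /eqP <- /=.
by rewrite -(perm_size (perm_free_act xP sz_w)) size_map eqxx.
Qed.

Section Elements.
Local Open Scope group_scope.
Variable n : nat.
Implicit Types (s t : 'S_n) (U V : {set 'I_n}).

Definition scode s U : signed_seq :=
  [seq (val (s i), i \in U) | i <- enum 'I_n].

Lemma nth_scode s U (i : 'I_n) d : nth d (scode s U) i = (val (s i), i \in U).
Proof. by rewrite (nth_map i) ?size_enum_ord // nth_ord_enum. Qed.

Lemma scodeP s U : signed_perm n (scode s U).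
Proof.
apply: uniq_perm; rewrite ?iota_uniq // /unzip1 -map_comp.
  by rewrite map_inj_uniq ?enum_uniq // => i j /val_inj/perm_inj.
move=> i; rewrite mem_iota add0n /=.
apply/mapP/idP => [[j _ ->]|lt_in]; first exact: ltn_ord.
by exists (s^-1 (Ordinal lt_in)); rewrite ?mem_enum //= permKV.
Qed.

Lemma scode_inj s t U V : scode s U = scode t V -> s = t /\ U = V.
Proof.
move=> e; have ei i : (val (s i), i \in U) = (val (t i), i \in V).
  by rewrite -!(nth_scode _ _ _ (0, false)) e.
by split; [apply/permP => i | apply/setP => i]; case: (ei i) => [/val_inj].
Qed.

Lemma scode_onto x : signed_perm n x -> exists s U, x = scode s U.
Proof.
move=> xP; have sz_x := size_signed_perm xP.
pose f (i : 'I_n) : 'I_n := Ordinal (signed_perm_lt xP (ltn_ord i)).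
have f_inj : injective f.
  move=> i j /(congr1 val) /= e; apply/val_inj/eqP.
  have x_uniq : uniq (unzip1 x) by rewrite (perm_uniq xP) iota_uniq.
  rewrite -(nth_uniq 0 _ _ x_uniq) ?size_map ?sz_x ?ltn_ord //.
  by rewrite !(nth_map (0, false)) ?sz_x ?ltn_ord // e.
exists (perm f_inj), [set i : 'I_n | (nth (0, false) x i).2].
apply: (@eq_from_nth _ (0, false)) => [|i].
  by rewrite size_map size_enum_ord.
rewrite sz_x => lt_in; rewrite (nth_scode _ _ (Ordinal lt_in)) permE inE /=.
by case: (nth _ x i).
Qed.

Definition flips U : {perm symbol n} := \prod_(u <- enum U) flip u.

Lemma flipsE U a :
  flips U a = (a.1, [set x | (x \in a.2) (+) ((x \in U) && (x \notin a.1))]).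
Proof.
rewrite prod_flipE ?enum_uniq //; congr (_, _); apply/setP => x.
by rewrite !inE mem_enum.
Qed.

(** The inverse makes [scode s U], without inverse, the code of [sperm s U]. *)
Definition sperm s U : {perm symbol n} := relabel s^-1 * flips U.

Lemma sperm_decode s U w :
  size w = n -> sperm s U (decode n w) = decode n (act_cell (scode s U) w).
Proof.
move=> sz_w; rewrite permM permE flipsE /relabel_fun /=.
have memV (A : {set 'I_n}) i : (i \in s^-1 @: A) = (s i \in A).
  by rewrite -{1}(permK s i) mem_imset //; apply: perm_inj.
congr (_, _); apply/setP => i; rewrite !inE !memV !inE.
  rewrite (nth_act _ (scodeP s U) (ltn_ord i)) nth_scode /=.
  by case: (nth (Some false) w (s i)) => [a|].
rewrite (nth_act _ (scodeP s U) (ltn_ord i)) nth_scode /=.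
case: (nth (Some false) w (s i)) => [b|] /=.
  by rewrite andbT; case: b; case: (i \in U).
by rewrite andbF.
Qed.

Lemma sperm_inj s t U V : sperm s U = sperm t V -> s = t /\ U = V.
Proof.
move=> e; split.
  apply: invg_inj; apply/permP => x.
  have := congr1 (fun g : {perm symbol n} => (g ([set x], set0)).1) e.
  by rewrite /= !permM !flipsE ![relabel _ _]permE /= !imset_set1 => /set1_inj.
apply/setP => x.
have := congr1 (fun g : {perm symbol n} => (g (set0, set0)).2) e.
rewrite /= !permM !flipsE ![relabel _ _]permE /= !imset0 => /setP/(_ x).
by rewrite !inE !andbT !addFb.
Qed.

Lemma sperm_symbols s U (G : {set symbol n}) :
  G \subset symbols n -> sperm s U @: G \subset symbols n.
Proof.
move=> /subsetP sG; apply/subsetP => _ /imsetP[a /sG a_sym ->].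
have da : [disjoint a.1 & a.2] by move: a_sym; rewrite inE => /andP[].
rewrite -(encodeK da) sperm_decode ?size_encode // mem_symbols.
  by apply: act_cells; [apply: scodeP | apply: encode_cells].
by rewrite size_act (size_signed_perm (scodeP s U)).
Qed.

Lemma mem_sperm s U (G : {set symbol n}) w : size w = n ->
  (decode n (act_cell (scode s U) w) \in sperm s U @: G) = (decode n w \in G).
Proof.
by move=> sz_w; rewrite -sperm_decode // mem_imset //; apply: perm_inj.
Qed.

(** Along a signed permutation, the pairs of parallel 2-faces of a 3-face are
permuted and possibly reversed, which changes neither their numbers of members
nor, up to order, the list of these numbers. *)
Lemma gaussoid_sperm s U (G : {set symbol n}) :
  G \subset symbols n -> gaussoid (sperm s U @: G) -> gaussoid G.
Proof.
move=> sG; rewrite !gaussoidE sG => /andP[_ /allP loc]; apply/allP => w w3.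
have xP := scodeP s U; set x := scode s U in xP.
have sz_w : size w = n by move: w3; rewrite mem_cells => /andP[/eqP].
have := loc _ (act_cells xP w3); set d := map _ _; congr (_ = true).
rewrite -(perm_admissible (perm_map _ (perm_free_act xP sz_w))) -map_comp /d.
congr admissible; apply/eq_in_map => i; rewrite mem_filter mem_iota add0n.
rewrite size_act (size_signed_perm xP) => /and3P[_ _ lt_in] /=.
have mG b : (decode n (facet (act_cell x w) i b) \in sperm s U @: G) =
    (decode n (facet w (nth (0, false) x i).1 (b (+) (nth (0, false) x i).2))
       \in G).
  rewrite -(mem_sperm s U G) -/x.
    by rewrite (act_facet _ xP) // addbK.
  by rewrite size_set_nth sz_w (maxn_idPr _) // (signed_perm_lt xP).
by rewrite !mG; case: (nth _ x i).2 => //=; rewrite addnC.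
Qed.

End Elements.

(** * Orbits by counting fixed gaussoids *)

Section Burnside.
Local Open Scope group_scope.
Variable n : nat.
Implicit Types (s t : 'S_n) (U V : {set 'I_n}) (G : {set symbol n}).

Lemma symbols_sperm s U a : (sperm s U a \in symbols n) = (a \in symbols n).
Proof.
have sub : symbols n \subset sperm s U @^-1: symbols n.
  by rewrite -sub_imset_pre; apply: sperm_symbols.
have : sperm s U @^-1: symbols n = symbols n.
  by apply/esym/eqP; rewrite eqEcard sub (card_preimset _ (@perm_inj _ _)) leqnn.
by move/setP/(_ a); rewrite inE.
Qed.

(** The converse of [gaussoid_sperm] comes from finiteness: an injective map whose
preimage of the gaussoids consists of gaussoids permutes them. *)
Lemma gaussoids_sperm s U G :
  (sperm s U @: G \in gaussoids n) = (G \in gaussoids n).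
Proof.
pose f (A : {set symbol n}) := sperm s U @: A.
have sub : f @^-1: gaussoids n \subset gaussoids n.
  apply/subsetP => A; rewrite !inE => gA; apply: (@gaussoid_sperm _ s U) => //.
  have /andP[/subsetP sA _] := gA; apply/subsetP => a aA.
  by rewrite -(symbols_sperm s U) sA // imset_f.
have f_inj : injective f by apply: imset_inj; apply: perm_inj.
have : f @^-1: gaussoids n = gaussoids n.
  by apply/eqP; rewrite eqEcard sub (card_preimset _ f_inj) leqnn.
by move/setP/(_ G); rewrite inE.
Qed.

Definition fixed s U := [set G in gaussoids n | sperm s U @: G == G].

(** The three groups are the sets of signed permutations whose set of sign changes
satisfies a condition [Q]; by injectivity of [sperm], sums over them are sums
over pairs. *)
Lemma orbit_count Q (H : {group {perm symbol n}}) :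
    H = [set sperm p.1 p.2 | p in [set p : 'S_n * {set 'I_n} | Q p.2]]
      :> {set _} ->
  (num_orbits H * #|[set p : 'S_n * {set 'I_n} | Q p.2]| =
     \sum_(p : 'S_n * {set 'I_n} | Q p.2) #|fixed p.1 p.2|)%N.
Proof.
move=> defH; pose I := [set p : 'S_n * {set 'I_n} | Q p.2].
have inj : {in I &, injective (fun p => sperm p.1 p.2)}.
  by move=> [s U] [t V] _ _ /sperm_inj[/= -> ->].
have cardH : #|H| = #|I| by rewrite defH card_in_imset.
have actsH : [acts H, on gaussoids n | 'P^*].
  apply/subsetP => g; rewrite defH => /imsetP[p _ ->].
  by apply/astabsP => G; apply: gaussoids_sperm.
rewrite -cardH /num_orbits -(Frobenius_Cauchy actsH) defH big_imset //=.
apply: eq_big => [p | p _]; first by rewrite inE.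
by congr #|pred_of_set _|; apply/setP => G; rewrite !inE /= sub1set inE.
Qed.

Lemma flips0 : flips set0 = 1 :> {perm symbol n}.
Proof. by rewrite /flips enum_set0 big_nil. Qed.

Lemma flipsT : flips [set: 'I_n] = duality n.
Proof.
apply/permP => a; rewrite flipsE prod_flipE ?index_enum_uniq //.
by congr (_, _); apply/setP => x; rewrite !inE mem_index_enum.
Qed.

Lemma flipsM U V : flips U * flips V = flips ((U :\: V) :|: (V :\: U)).
Proof.
apply/permP => a; rewrite permM !flipsE; congr (_, _).
apply/setP => x; rewrite !inE.
by case: (x \in a.1); case: (x \in a.2); case: (x \in U); case: (x \in V).
Qed.

Lemma flip_groupE : flip_group n = [set flips U | U : {set 'I_n}] :> {set _}.
Proof.
apply/eqP; rewrite eqEsubset; apply/andP; split; last first.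
  apply/subsetP => _ /imsetP[U _ ->]; rewrite /flips big_seq.
  by apply: group_prod => u _; rewrite mem_gen ?imset_f.
have gF : group_set [set flips U | U : {set 'I_n}].
  apply/group_setP; split; first by apply/imsetP; exists set0; rewrite ?flips0.
  by move=> _ _ /imsetP[U _ ->] /imsetP[V _ ->]; rewrite flipsM imset_f.
rewrite -[X in _ \subset pred_of_set X]/(gval (Group gF)) gen_subG /=.
apply/subsetP => _ /imsetP[u _ ->].
by apply/imsetP; exists [set u]; rewrite // /flips enum_set1 big_seq1.
Qed.

Lemma duality_cycleE : <[duality n]> = [set flips U | U in [set set0; setT]].
Proof.
rewrite imsetU1 imset_set1 flips0 flipsT; apply/setP => g; rewrite !inE.
apply/cycleP/idP => [[i ->]|/orP[]/eqP->]; last 2 first.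
- by exists 0%N; rewrite expg0.
- by exists 1%N; rewrite expg1.
elim: i => [|i /orP[]/eqP IHi]; first by rewrite eqxx.
  by rewrite expgS IHi mulg1 eqxx orbT.
rewrite expgS IHi -flipsT flipsM setDv setU0 flips0 eqxx //.
Qed.

Lemma mul_relabelE (F : {set {set 'I_n}}) :
  [set relabel s | s : 'S_n] * [set flips U | U in F] =
    [set sperm p.1 p.2 | p in [set p : 'S_n * {set 'I_n} | p.2 \in F]].
Proof.
apply/setP => g; apply/mulsgP/imsetP => [[r f /imsetP[s _ ->{r}]]|[[s U]]].
  move=> /imsetP[U FU ->] ->.
  by exists (s^-1, U); rewrite ?inE // /sperm invgK.
rewrite inE => FU ->; exists (relabel s^-1) (flips U) => //; exact: imset_f.
Qed.

Lemma relabel_group_sperm : relabel_group n =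
  [set sperm p.1 p.2
  | p in [set p : 'S_n * {set 'I_n} | p.2 \in [set set0]]] :> {set _}.
Proof. by rewrite -mul_relabelE imset_set1 flips0 mulg1 relabel_groupE. Qed.

Lemma twisted_group_sperm : twisted_group n =
  [set sperm p.1 p.2
  | p in [set p : 'S_n * {set 'I_n} | p.2 \in [set set0; setT]]] :> {set _}.
Proof.
rewrite -(sdprodWC (twisted_group_sdprod n)) -mul_relabelE relabel_groupE.
by rewrite duality_cycleE.
Qed.

Lemma hyperoctahedral_group_sperm : hyperoctahedral_group n =
  [set sperm p.1 p.2
  | p in [set p : 'S_n * {set 'I_n} | p.2 \in setT]] :> {set _}.
Proof.
rewrite -(sdprodWC (hyperoctahedral_group_sdprod n)) -mul_relabelE relabel_groupE.
rewrite flip_groupE; congr (_ * _).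
by apply/setP => g; apply/imsetP/imsetP => -[U]; exists U; rewrite ?inE.
Qed.

End Burnside.

(** * Fixed gaussoids as solutions of constraints *)

Section Quotient.
Variable pi : seq nat.

(** The least element met on the way along the orbit of [i], from [j] until the
return to [i], within [k] steps. Whatever [k] is, it lies in the orbit. *)
Fixpoint least k i j m :=
  if k is k'.+1 then
    let j' := nth 0 pi j in
    if eqn j' i then m else least k' i j' (if j' < m then j' else m)
  else m.

Lemma least_orbit k i : exists d, least k i i i = iter d (nth 0 pi) i.
Proof.
suff: forall j m, (exists d, j = iter d (nth 0 pi) i) ->
    (exists d, m = iter d (nth 0 pi) i) ->
  exists d, least k i j m = iter d (nth 0 pi) i by apply; exists 0.
elim: k => //= k IHk j m j_orb m_orb; case: eqn => //.
have j'_orb : exists d, nth 0 pi j = iter d (nth 0 pi) i.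
  by case: j_orb => d ->; exists d.+1.
by apply: IHk => //; case: ifP.
Qed.

Definition reps_of k := [seq least k i i i | i <- iota 0 (size pi)].

(** [rs] sends a position to a representative of its orbit under [pi]. *)
Variable rs : seq nat.
Let m := size pi.
Hypothesis pi_lt : forall i, i < m -> nth 0 pi i < m.
Hypothesis rs_orbit :
  forall i, i < m -> exists d, nth 0 rs i = iter d (nth 0 pi) i.
Hypothesis rs_pi : forall i, i < m -> nth 0 rs (nth 0 pi i) = nth 0 rs i.

Lemma iter_lt d i : i < m -> iter d (nth 0 pi) i < m.
Proof. by move=> lt_im; elim: d => //= d; apply: pi_lt. Qed.

Lemma rs_lt i : i < m -> nth 0 rs i < m.
Proof. by move=> lt_im; have [d ->] := rs_orbit lt_im; apply: iter_lt. Qed.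

Lemma rs_idem i : i < m -> nth 0 rs (nth 0 rs i) = nth 0 rs i.
Proof.
move=> lt_im; have [d {1}->] := rs_orbit lt_im.
by elim: d => //= d IHd; rewrite rs_pi ?iter_lt.
Qed.

Definition invariant (b : bitseq) :=
  all (fun i => nth false b (nth 0 pi i) == nth false b i) (iota 0 m).

Lemma invariantP b :
  reflect (forall i, i < m -> nth false b i = nth false b (nth 0 rs i))
          (invariant b).
Proof.
apply: (iffP allP) => [b_pi i lt_im | b_rs i].
  have [d ->] := rs_orbit lt_im; elim: d => //= d ->.
  by apply/esym/eqP/b_pi; rewrite mem_iota iter_lt.
rewrite mem_iota => /= lt_im.
by rewrite b_rs ?pi_lt // rs_pi // -b_rs.
Qed.

Definition orbit_reps := [seq i <- iota 0 m | nth 0 rs i == i].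

Definition labels := [seq index (nth 0 rs i) orbit_reps | i <- iota 0 m].

Definition expand (c : bitseq) : bitseq := [seq nth false c l | l <- labels].

Lemma mem_orbit_reps i : i < m -> nth 0 rs i \in orbit_reps.
Proof. by move=> lt_im; rewrite mem_filter rs_idem // eqxx mem_iota rs_lt. Qed.

Lemma nth_labels i : i < m -> nth 0 labels i = index (nth 0 rs i) orbit_reps.
Proof. by move=> lt_im; rewrite (nth_map 0) ?size_iota // nth_iota. Qed.

Lemma labels_lt i : i < m -> nth 0 labels i < size orbit_reps.
Proof. by move=> lt_im; rewrite nth_labels // index_mem mem_orbit_reps. Qed.

Lemma nth_expand c i :
  i < m -> nth false (expand c) i = nth false c (nth 0 labels i).
Proof. by move=> lt_im; rewrite (nth_map 0) // size_map size_iota. Qed.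

(** An invariant word is determined by its letters at the representatives, and
these are arbitrary. *)
Lemma perm_invariant :
  perm_eq [seq b <- words m | invariant b]
          [seq expand c | c <- words (size orbit_reps)].
Proof.
have o_uniq : uniq orbit_reps by rewrite filter_uniq ?iota_uniq.
have o_lt r : r \in orbit_reps -> r < m.
  by rewrite mem_filter mem_iota => /and3P[].
have o_rs r : r \in orbit_reps -> nth 0 rs r = r.
  by rewrite mem_filter => /andP[/eqP].
have expandK c : size c = size orbit_reps ->
    [seq nth false (expand c) r | r <- orbit_reps] = c.
  move=> sz_c; apply: (@eq_from_nth _ false) => [|j].
    by rewrite size_map.
  rewrite size_map => lt_jM.
  have rP := mem_nth 0 lt_jM; rewrite (nth_map 0) // nth_expand ?o_lt //.
  by rewrite nth_labels ?o_lt // o_rs // index_uniq.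
apply: uniq_perm; first by rewrite filter_uniq ?words_uniq.
  rewrite map_inj_in_uniq ?words_uniq // => c c'.
  by rewrite !mem_words => /eqP/expandK{2}<- /eqP/expandK{2}<- ->.
move=> b; rewrite mem_filter mem_words.
apply/andP/mapP => [[/invariantP b_inv /eqP sz_b]|].
  exists [seq nth false b r | r <- orbit_reps].
    by rewrite mem_words size_map.
  apply: (@eq_from_nth _ false) => [|i]; first by rewrite !size_map size_iota.
  rewrite sz_b => lt_im.
  rewrite nth_expand // (nth_map 0) ?labels_lt // nth_labels //.
  by rewrite nth_index ?mem_orbit_reps // -b_inv.
case=> c; rewrite mem_words => /eqP sz_c ->.
split; last by rewrite !size_map size_iota.
apply/invariantP => i lt_im; rewrite !nth_expand ?rs_lt //.
by rewrite !nth_labels ?rs_lt // rs_idem.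
Qed.

End Quotient.

(** The labels in [ls], as a mask and in increasing order, with the words of
values that make the pattern admissible. Labels may be repeated in [ls], when an
orbit meets a 3-face several times. *)
Definition constraint M (ls : seq (nat * nat)) : bitseq * seq bitseq :=
  let vs := [seq i <- iota 0 M | has (fun l => (i == l.1) || (i == l.2)) ls] in
  let ps := [seq (index l.1 vs, index l.2 vs) | l <- ls] in
  ([seq has (fun l => (i == l.1) || (i == l.2)) ls | i <- iota 0 M],
   [seq u <- words (size vs) |
      admissible [seq nth false u p.1 + nth false u p.2 | p <- ps]]).

Lemma constraintP M ls c :
    size c = M -> all (fun l => (l.1 < M) && (l.2 < M)) ls ->
  (mask (constraint M ls).1 c \in (constraint M ls).2) =
    admissible [seq nth false c l.1 + nth false c l.2 | l <- ls].
Proof.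
move=> sz_c lt_ls; rewrite /constraint /=.
set vs := [seq i <- iota 0 M | _].
have -> :
    mask [seq has (fun l => (i == l.1) || (i == l.2)) ls | i <- iota 0 M] c =
    [seq nth false c i | i <- vs].
  by rewrite -[c in LHS](mkseq_nth false) sz_c /mkseq -map_mask -filter_mask.
rewrite mem_filter mem_words size_map eqxx andbT -map_comp.
congr admissible; apply/eq_in_map => l l_ls /=.
have /andP[lt1 lt2] := allP lt_ls l l_ls.
have in1 : l.1 \in vs.
  rewrite mem_filter mem_iota add0n lt1 /= andbT.
  by apply/hasP; exists l; rewrite ?eqxx.
have in2 : l.2 \in vs.
  rewrite mem_filter mem_iota add0n lt2 /= andbT.
  by apply/hasP; exists l; rewrite ?eqxx ?orbT.
by rewrite !(nth_map 0) ?index_mem // !nth_index.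
Qed.

Lemma wf_constraint M ls :
    ls != [::] -> all (fun l => (l.1 < M) && (l.2 < M)) ls ->
  (size (constraint M ls).1 == M) && has id (constraint M ls).1.
Proof.
case: ls => //= l ls _ /andP[/andP[lt1 _] _].
rewrite size_map size_iota eqxx /=.
rewrite has_map; apply/hasP; exists l.1; first by rewrite mem_iota.
by rewrite /= eqxx.
Qed.

Section Fixed.
Variable n : nat.
Implicit Types (G : {set symbol n}) (s : 'S_n) (U : {set 'I_n}).

Definition facet_indices : seq (seq (nat * nat)) :=
  let C := cells n 2 in
  [seq [seq (index f.1 C, index f.2 C) | f <- facets w] | w <- cells n 3].

Definition act_indices x : seq nat :=
  let C := cells n 2 in [seq index (act_cell x w) C | w <- C].

Definition bit (b : bitseq) w := nth false b (index w (cells n 2)).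

Definition bits (G : {set symbol n}) := [seq decode n w \in G | w <- cells n 2].

Definition local_bits (b : bitseq) :=
  all (fun t => admissible [seq nth false b l.1 + nth false b l.2 | l <- t])
      facet_indices.

Lemma nth_bits G w : w \in cells n 2 -> bit (bits G) w = (decode n w \in G).
Proof. by move=> wC; rewrite /bit (nth_map [::]) ?index_mem // nth_index. Qed.

Lemma facet_cells w i b :
  w \in cells n 3 -> i \in free w -> facet w i b \in cells n 2.
Proof.
rewrite !mem_cells mem_filter mem_iota.
move=> /andP[/eqP sz_w /eqP w3] /and3P[/eqP wi _].
rewrite sz_w => lt_in; rewrite size_set_nth sz_w (maxn_idPr lt_in) eqxx /=.
by rewrite count_set_nth_ltn ?sz_w // w3 wi.
Qed.

Lemma local_bitsE G : G \subset symbols n -> local_bits (bits G) = gaussoid G.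
Proof.
move=> sG; rewrite gaussoidE sG /local_bits /facet_indices all_map /=.
apply: eq_in_all => w w3 /=; rewrite /facets -!map_comp; congr admissible.
apply/eq_in_map => i wi /=.
by rewrite -!/(bit _ _) !nth_bits ?facet_cells.
Qed.

(** An injective image of [G] contained in [G] is [G], so it suffices that the
2-faces in [G] are sent into [G]. *)
Lemma invariant_bits s U G : G \subset symbols n ->
  invariant (act_indices (scode s U)) (bits G) = (sperm s U @: G == G).
Proof.
move=> /subsetP sG; have xP := scodeP s U.
have sz w : w \in cells n 2 -> size w = n by rewrite mem_cells => /andP[/eqP].
have -> : invariant (act_indices (scode s U)) (bits G) =
    all (fun w => (decode n (act_cell (scode s U) w) \in G)
                    == (decode n w \in G)) (cells n 2).
  rewrite /invariant size_map -[in RHS](mkseq_nth [::] (cells n 2)) all_map.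
  apply: eq_in_all => i; rewrite mem_iota => /= lt_iN.
  rewrite (nth_map [::] 0) // -/(bit _ _) nth_bits ?(act_cells xP) ?mem_nth //.
  by rewrite (nth_map [::]).
apply/allP/eqP => [inv | GE w wC].
  apply/eqP; rewrite eqEcard card_imset ?leqnn ?andbT; last exact: perm_inj.
  apply/subsetP => _ /imsetP[a aG ->]; have a_sym := sG a aG.
  have da : [disjoint a.1 & a.2] by move: a_sym; rewrite inE => /andP[].
  have /eqP := inv _ (encode_cells a_sym).
  by rewrite -(sperm_decode s U) ?size_encode // encodeK // => ->.
by apply/eqP; rewrite -[in LHS]GE mem_sperm ?sz.
Qed.

Lemma card_fixed s U :
  #|fixed s U| =
    count (predI local_bits (invariant (act_indices (scode s U))))
          (words (size (cells n 2))).
Proof.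
pose sets b := [set a in symbols n | bit b (encode a)].
have sets_sub b : sets b \subset symbols n.
  by apply/subsetP => a; rewrite inE => /andP[].
have bitsK G : G \subset symbols n -> sets (bits G) = G.
  move/subsetP => sG; apply/setP => a; rewrite in_set.
  case a_sym: (a \in symbols n) => /=; last first.
    by apply/esym/negbTE; apply: contraFN a_sym; apply: sG.
  rewrite nth_bits ?encode_cells // encodeK //.
  by move: a_sym; rewrite inE => /andP[].
have setsK b : size b = size (cells n 2) -> bits (sets b) = b.
  move=> sz_b; apply: (@eq_from_nth _ false) => [|i]; rewrite size_map ?sz_b //.
  move=> lt_iN.
  rewrite (nth_map [::]) //; set w := nth _ _ i.
  have wC : w \in cells n 2 by rewrite mem_nth.
  have sz_w : size w = n by move: wC; rewrite mem_cells => /andP[/eqP].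
  by rewrite in_set mem_symbols // wC decodeK // /bit index_uniq ?cells_uniq.
set P := predI _ _.
have PE G : G \subset symbols n -> P (bits G) = (G \in fixed s U).
  by move=> sG; rewrite /= local_bitsE // invariant_bits // !inE.
have defF : fixed s U =i [seq sets b | b <- words (size (cells n 2)) & P b].
  move=> G; apply/idP/mapP => [GF | [b]].
    have sG : G \subset symbols n by move: GF; rewrite !inE => /andP[/andP[]].
    exists (bits G); rewrite ?bitsK // mem_filter PE // GF mem_words.
    by rewrite size_map eqxx.
  rewrite mem_filter mem_words => /andP[Pb /eqP sz_b] ->.
  by rewrite -PE // setsK.
rewrite (eq_card defF) (card_uniqP _) ?size_map ?size_filter //.
rewrite map_inj_in_uniq ?filter_uniq ?words_uniq // => b b'.
rewrite !mem_filter !mem_words.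
move=> /andP[_ /eqP/setsK{2}<-] /andP[_ /eqP/setsK{2}<-].
by move->.
Qed.

End Fixed.

Section FixCount.
Variables (m : nat) (T : seq (seq (nat * nat))) (pi : seq nat) (k : nat).

(** Tested by computation in place of a proof that [k] steps suffice to run
through each orbit. *)
Definition orbits_closed :=
  let rs := reps_of pi k in
  all (fun i => nth 0 rs (nth 0 pi i) == nth 0 rs i) (iota 0 (size pi)).

(** Duplicate constraints come from 3-faces in the same orbit. *)
Definition fix_count : N :=
  let rs := reps_of pi k in
  let ls := labels pi rs in
  let M := size (orbit_reps pi rs) in
  let T' := undup [seq [seq (nth 0 ls l.1, nth 0 ls l.2) | l <- t] | t <- T] in
  count_models M [seq constraint M t | t <- T'].

Hypothesis size_pi : size pi = m.
Hypothesis pi_lt : forall i, i < m -> nth 0 pi i < m.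
Hypothesis T_lt :
  all (fun t => (t != [::]) && all (fun l => (l.1 < m) && (l.2 < m)) t) T.

Lemma fix_countE : orbits_closed ->
  fix_count =
    count (predI
             (fun b => all (fun t =>
                admissible [seq nth false b l.1 + nth false b l.2 | l <- t]) T)
             (invariant pi)) (words m) :> nat.
Proof.
move=> /allP closed; set rs := reps_of pi k in closed.
have rs_orbit i : i < size pi -> exists d, nth 0 rs i = iter d (nth 0 pi) i.
  move=> lt_iN; rewrite /rs /reps_of (nth_map 0) ?size_iota // nth_iota //.
  rewrite add0n; exact: least_orbit.
have pi_lt' i : i < size pi -> nth 0 pi i < size pi.
  by rewrite size_pi; apply: pi_lt.
have rs_pi i : i < size pi -> nth 0 rs (nth 0 pi i) = nth 0 rs i.
  by move=> lt_iN; apply/eqP/closed; rewrite mem_iota.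
rewrite /fix_count -/rs; set ls := labels pi rs; set M := size _.
set T' := undup _.
have ls_lt i : i < m -> nth 0 ls i < M.
  by rewrite -size_pi => lt_iN; apply: labels_lt.
have T'_lt :
    all (fun t => (t != [::]) && all (fun l => (l.1 < M) && (l.2 < M)) t) T'.
  apply/allP => t'; rewrite mem_undup => /mapP[t tT ->{t'}].
  have /andP[t0 t_lt] := allP T_lt t tT.
  apply/andP; split; first by case: (t) t0.
  rewrite all_map; apply: sub_all t_lt => l /= /andP[lt1 lt2].
  by rewrite !ls_lt.
rewrite count_modelsE; last first.
  rewrite /wf all_map; apply: sub_all T'_lt => t /= /andP[].
  exact: wf_constraint.
rewrite -count_filter -size_pi.
have /seq.permP-> := perm_invariant pi_lt' rs_orbit rs_pi.
rewrite count_map; apply: eq_in_count => c; rewrite mem_words => /eqP sz_c.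
rewrite /satisfies all_map (eq_all_r (mem_undup _)) all_map.
apply: eq_in_all => t tT /=.
have /andP[_ t_lt] := allP T_lt t tT.
rewrite constraintP //; last first.
  rewrite all_map; apply: sub_all t_lt => l /= /andP[lt1 lt2].
  by rewrite !ls_lt.
rewrite -map_comp; congr admissible.
apply/eq_in_map => l /(allP t_lt)/andP[lt1 lt2] /=.
by rewrite !nth_expand ?size_pi.
Qed.

End FixCount.

(** * Conjugacy of signed permutations *)

Definition smul (x y : signed_seq) : signed_seq :=
  [seq (let q := nth (0, false) y p.1 in (q.1, p.2 (+) q.2)) | p <- x].

Lemma act_smul n x y w : signed_perm n x -> signed_perm n y ->
  act_cell (smul x y) w = act_cell x (act_cell y w).
Proof.
move=> xP yP; rewrite /act_cell -map_comp; apply/eq_in_map => p px /=.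
have lt_pn : p.1 < n.
  by have := perm_mem xP p.1; rewrite mem_iota add0n /= map_f.
rewrite (nth_map (0, false)) ?(size_signed_perm yP) //.
by case: (nth (Some false) w _) => //= b; rewrite addbA.
Qed.

(** The conjugating element maps the gaussoids fixed by one element bijectively to
those fixed by the other. The products of codes describe the action on symbols
only, which is enough since gaussoids consist of symbols. *)
Lemma card_fixed_conj n (s t u : 'S_n) (U V W : {set 'I_n}) :
    smul (scode t V) (scode u W) = smul (scode u W) (scode s U) ->
  #|fixed s U| = #|fixed t V|.
Proof.
move=> conj; pose f (G : {set symbol n}) := sperm u W @: G.
have f_inj : injective f by apply: imset_inj; apply: perm_inj.
suff <- : f @^-1: fixed t V = fixed s U by rewrite (card_preimset _ f_inj).
apply/setP => G.
rewrite [in LHS]in_set [in LHS]in_set [in RHS]in_set gaussoids_sperm.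
case G_gauss: (G \in gaussoids n) => //=.
have sG : G \subset symbols n by move: G_gauss; rewrite inE => /andP[].
rewrite -[RHS](inj_eq f_inj); congr (_ == _).
rewrite /f -!imset_comp; apply: eq_in_imset => a /(subsetP sG) a_sym /=.
have da : [disjoint a.1 & a.2] by move: a_sym; rewrite inE => /andP[].
have sz_a := size_encode a; have szV := size_signed_perm (scodeP _ _).
rewrite -(encodeK da) !sperm_decode ?size_act ?szV //.
by rewrite -!(act_smul _ (scodeP _ _) (scodeP _ _)) conj.
Qed.

(** The cycle of [i], from [j] on, where each point carries the sign [e] collected
on the way to it; [k] bounds the length. *)
Fixpoint walk (x : signed_seq) k i j (e : bool) : signed_seq :=
  if k is k'.+1 then
    let q := nth (0, false) x j in
    (j, e) :: (if eqn q.1 i then [::] else walk x k' i q.1 (e (+) q.2))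
  else [::].

(** Each cycle, preceded by the product of its signs, is kept only in the version
that starts at its least point. *)
Definition cycles x : seq (bool * seq (nat * bool)) :=
  [seq (foldr (fun p e => (nth (0, false) x p.1).2 (+) e) false c, c)
  | c <- [seq c <- [seq walk x (size x) i i false | i <- iota 0 (size x)]
         | if c is (i, _) :: c' then all (fun p => i < p.1) c' else false]].

(** A product of signed cycles on consecutive intervals starting at [o]: only the
step back from the last point of a cycle to its first one carries a sign. *)
Fixpoint blocks o (ls : seq (nat * bool)) : seq (nat * bool) :=
  if ls is (l, e) :: ls' then
    rcons [seq (i, false) | i <- iota o.+1 l.-1] (o, e) ++ blocks (o + l) ls'
  else [::].

(** If [normal_form x = (y, r)], then [y] lists the cycles of [x], sorted by
length and sign and with accumulated signs, and [r] is the same product of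
cycles on intervals. Thus [smul r y = smul y x]: one step of [x] along a cycle
is one step to the right in the list. This equation is tested for each element. *)
Definition normal_form x : seq (nat * bool) * seq (nat * bool) :=
  let cs0 := cycles x in
  let cs := flatten [seq [seq c <- cs0 | (c.1 == e) && (size c.2 == l)]
                    | l <- iota 1 (size x), e <- [:: false; true]] in
  (flatten (map snd cs), blocks 0 [seq (size c.2, c.1) | c <- cs]).

Definition signed_perms n : seq signed_seq :=
  [seq zip p e | p <- permutations (iota 0 n), e <- words n].

Lemma mem_signed_perms n x : (x \in signed_perms n) = signed_perm n x.
Proof.
apply/allpairsP/idP => [[[p e] /= []]|xP].
  rewrite mem_permutations mem_words => p_perm /eqP sz_e ->.
  by rewrite /signed_perm unzip1_zip // sz_e (perm_size p_perm) size_iota.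
exists (unzip1 x, unzip2 x); rewrite /= mem_permutations mem_words zip_unzip.
by rewrite size_map (size_signed_perm xP).
Qed.

Lemma signed_perms_uniq n : uniq (signed_perms n).
Proof.
apply: allpairs_uniq; rewrite ?permutations_uniq ?words_uniq //.
move=> [p e] [p' e'] /allpairsP[[q f] /= [Pq Wf [-> ->]]].
move=> /allpairsP[[q' f'] /= [Pq' Wf' [-> ->]]] /=.
have sz r g :
    r \in permutations (iota 0 n) -> g \in words n -> size r = size g.
  rewrite mem_permutations mem_words => /perm_size-> /eqP->.
  by rewrite size_iota.
move=> eq_zip; have := congr1 unzip1 eq_zip; have := congr1 unzip2 eq_zip.
rewrite !unzip1_zip ?unzip2_zip ?(sz _ _ Pq Wf) ?(sz _ _ Pq' Wf') //.
by move=> -> ->.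
Qed.

Lemma perm_scode n :
  perm_eq [seq scode p.1 p.2 | p : 'S_n * {set 'I_n}] (signed_perms n).
Proof.
apply: uniq_perm; last 1 first.
- move=> x; rewrite mem_signed_perms.
  apply/imageP/idP => [[p _ ->]|]; first exact: scodeP.
  by case/scode_onto => s [U ->]; exists (s, U).
- rewrite map_inj_uniq ?enum_uniq // => -[s U] [t V] /scode_inj[/= -> ->] //.
- exact: signed_perms_uniq.
Qed.

(** * The census by conjugacy classes *)

Lemma free3 n w : w \in cells n 3 -> size (free w) = 3.
Proof. by rewrite mem_cells size_free => /andP[_ /eqP]. Qed.

Lemma facet_indices_lt n :
  all (fun t => (t != [::]) &&
         all (fun l => (l.1 < size (cells n 2)) && (l.2 < size (cells n 2))) t)
      (facet_indices n).
Proof.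
rewrite all_map; apply/allP => w w3 /=.
rewrite -size_eq0 !size_map (free3 w3) /=.
rewrite !all_map; apply/allP => i wi /=.
by rewrite !index_mem !facet_cells.
Qed.

Lemma act_indices_lt n x i : signed_perm n x -> i < size (cells n 2) ->
  nth 0 (act_indices n x) i < size (cells n 2).
Proof.
by move=> xP lt_i; rewrite (nth_map [::]) // index_mem (act_cells xP) ?mem_nth.
Qed.

(** No orbit has more than [2 * n.+1] elements if [n] is 3, 4 or 5, where the
elements of the hyperoctahedral group have order at most 6, 8 and 12. *)
Definition fix_number n T r := fix_count T (act_indices n r) (2 * n.+1).

Lemma fix_numberE n (s : 'S_n) (U : {set 'I_n}) :
    orbits_closed (act_indices n (scode s U)) (2 * n.+1) ->
  #|fixed s U| = fix_number n (facet_indices n) (scode s U).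
Proof.
move=> closed; have xP := scodeP s U; rewrite /fix_number.
rewrite (@fix_countE (size (cells n 2))) ?card_fixed ?size_map //.
  by move=> i; apply: act_indices_lt.
exact: facet_indices_lt.
Qed.

(** In contrast to [undup], elements are only compared with those already found to
be distinct; there are few normal forms among many signed permutations. *)
Definition distinct (T : eqType) (s : seq T) :=
  foldr (fun x acc => if x \in acc then acc else x :: acc) [::] s.

Lemma mem_distinct (T : eqType) (s : seq T) : distinct s =i s.
Proof.
elim: s => //= x s IHs y; rewrite fun_if (in_cons x s y) -IHs.
by case: ifP => //= x_in; case: eqP => // ->.
Qed.

Lemma distinct_uniq (T : eqType) (s : seq T) : uniq (distinct s).
Proof. by elim: s => //= x s IHs; case: ifP => //= ->. Qed.

Lemma sum_by_value (T V : eqType) (L : seq T) (P : pred T) (h : T -> V)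
    (F : V -> nat) R :
    uniq R -> {in L, forall x, h x \in R} ->
  \sum_(x <- L | P x) F (h x) =
    \sum_(r <- R) count (fun x => P x && (h x == r)) L * F r.
Proof.
move=> R_uniq; elim: L => [|x L IHL] hR /=; first by rewrite big_nil big1.
rewrite big_cons IHL => [|y yL]; last by rewrite hR // inE yL orbT.
under [RHS]eq_bigr do rewrite mulnDl.
rewrite big_split /=.
have -> : \sum_(r <- R) (P x && (h x == r)) * F r = P x * F (h x).
  rewrite (bigD1_seq (h x)) ?hR ?mem_head //= eqxx andbT big1 ?addn0 // => r.
  by rewrite eq_sym => /negPf->; rewrite andbF.
by case: (P x); rewrite ?mul1n.
Qed.

Definition addN a b :=
  match a, b with
  | N0, _ => b
  | _, N0 => a
  | Npos p, Npos q => Npos (Pos.add p q)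
  end.

Definition mulN a b :=
  match a, b with
  | Npos p, Npos q => Npos (Pos.mul p q)
  | _, _ => N0
  end.

Lemma addNE a b : addN a b = a + b :> nat.
Proof. by case: a b => [|p] [|q] //=; rewrite ?addn0 // nat_of_add_pos. Qed.

Lemma mulNE a b : mulN a b = a * b :> nat.
Proof. by case: a b => [|p] [|q] //=; rewrite ?muln0 // nat_of_mul_pos. Qed.

(** The sign patterns in the symmetric group, and in its product with the diagonal
of the group of flips. *)
Definition untwisted (e : bitseq) := ~~ has id e.
Definition diagonal (e : bitseq) := ~~ has id e || all id e.

Section Census.
Variables (n : nat) (g a b c : N).

Notation normal_data := (signed_seq * (signed_seq * signed_seq))%type.

Definition class_data : seq normal_data :=
  [seq (x, normal_form x) | x <- signed_perms n].

Definition conjugation_ok (d : normal_data) :=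
  let: (x, (y, r)) := d in
  [&& signed_perm n y, signed_perm n r & smul r y == smul y x].

Definition fix_table (data : seq normal_data) T :=
  [seq (r, fix_number n T r) | r <- distinct [seq d.2.2 | d <- data]].

Definition weighted_sum (data : seq normal_data) (Q : pred bitseq)
    (table : seq (signed_seq * N)) : N :=
  let multiplicity (r : signed_seq) :=
    count (fun d => Q (unzip2 d.1) && (d.2.2 == r)) data in
  foldr (fun row => addN (mulN (bin_of_nat (multiplicity row.1)) row.2))
    N0 table.

(** The tests behind the counts: [g] is the number of sets fixed by the normal
form of the identity, and [a], [b], [c], multiplied by the orders of the groups,
are the sums of the numbers of fixed gaussoids. *)
Definition census_check : bool :=
  let data := class_data in
  let table := fix_table data (facet_indices n) in
  let id_form := (normal_form (zip (iota 0 n) (nseq n false))).2 in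
  let order Q := count (fun x => Q (unzip2 x)) (signed_perms n) in
  let ok Q o := (0 < order Q) &&
    (weighted_sum data Q table == mulN o (bin_of_nat (order Q))) in
  [&& all conjugation_ok data,
      all (fun row => orbits_closed (act_indices n row.1) (2 * n.+1)) table,
      all (fun row => (row.1 == id_form) ==> (row.2 == g)) table,
      ok untwisted a, ok diagonal b & ok predT c].

Hypothesis checked : census_check.

Let F r : nat := fix_number n (facet_indices n) r.

Let F_spec (s : 'S_n) (U : {set 'I_n}) :
  #|fixed s U| = F (normal_form (scode s U)).2.
Proof.
have /and5P[conj closed _ _ _] := checked; set x := scode s U.
have xL : x \in signed_perms n by rewrite mem_signed_perms scodeP.
have := allP conj _ (map_f (fun x => (x, normal_form x)) xL).
case def_nf: (normal_form x) => [y r] /= /and3P[yP rP /eqP conj_xr].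
have [u [W def_y]] := scode_onto yP; have [t [V def_r]] := scode_onto rP.
rewrite (@card_fixed_conj _ s t u U V W) -?def_y -?def_r //.
rewrite /F def_r -fix_numberE // -def_r.
have rR : r \in distinct [seq d.2.2 | d <- class_data].
  rewrite mem_distinct -map_comp; apply/mapP.
  by exists x; rewrite // -[LHS]/(y, r).2 -def_nf.
exact: allP closed _ (map_f (fun r => (r, fix_number n _ r)) rR).
Qed.

Lemma sum_signed_perms (Q : pred {set 'I_n}) (Q' : pred bitseq)
    (H : signed_seq -> nat) :
    (forall s U, Q U = Q' (unzip2 (scode s U))) ->
  \sum_(p : 'S_n * {set 'I_n} | Q p.2) H (scode p.1 p.2) =
    \sum_(x <- signed_perms n | Q' (unzip2 x)) H x.
Proof.
move=> QQ'; rewrite -(perm_big _ (perm_scode n)) big_map big_enum_cond /=.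
by apply: eq_bigl => -[s U] /=; rewrite -QQ'.
Qed.

Lemma orbits_of_check (Q : pred {set 'I_n}) (Q' : pred bitseq) (o : N)
    (H : {group {perm symbol n}}) :
    (forall s U, Q U = Q' (unzip2 (scode s U))) ->
    H = [set sperm p.1 p.2 | p in [set p : 'S_n * {set 'I_n} | Q p.2]]
      :> {set _} ->
    let order := count (fun x => Q' (unzip2 x)) (signed_perms n) in
    (0 < order) &&
      (weighted_sum class_data Q' (fix_table class_data (facet_indices n))
         == mulN o (bin_of_nat order)) ->
  num_orbits H = o.
Proof.
move=> QQ' defH order /andP[order_gt0 /eqP sum_eq].
have cardI : #|[set p : 'S_n * {set 'I_n} | Q p.2]| = order.
  rewrite -sum1_card /order -sum1_count -(sum_signed_perms (fun=> 1) QQ').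
  by apply: eq_bigl => p; rewrite inE.
apply/eqP; rewrite -(eqn_pmul2r order_gt0) -[X in _ * X == _]cardI.
rewrite orbit_count //.
rewrite -[X in _ == _ * X]bin_of_natK -mulNE -sum_eq; apply/eqP.
under eq_bigr do rewrite F_spec.
rewrite (sum_signed_perms (fun x => F (normal_form x).2) QQ').
rewrite (sum_by_value _ F (distinct_uniq [seq d.2.2 | d <- class_data])).
  2: by move=> x xL; rewrite mem_distinct -map_comp; apply/mapP; exists x.
rewrite /weighted_sum /fix_table.
elim: (distinct _) => [|r R IHR]; first by rewrite big_nil.
rewrite big_cons IHR /= addNE mulNE bin_of_natK; congr (_ * _ + _).
by rewrite count_map.
Qed.

Lemma census :
  [/\ #|gaussoids n| = g,
      num_orbits (relabel_group n) = a,
      num_orbits (twisted_group n) = b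
    & num_orbits (hyperoctahedral_group n) = c].
Proof.
have /and5P[_ _ g_ok a_ok /andP[b_ok c_ok]] := checked; split.
- have -> : gaussoids n = fixed 1%g set0.
    apply/setP => G; rewrite [in RHS]in_set /sperm flips0 mulg1 invg1.
    have -> : relabel 1 @: G = G; last by rewrite eqxx andbT.
    rewrite (_ : relabel 1 = 1%g) ?imset_perm1 //.
    by apply: (mulgI (relabel 1)); rewrite -relabelM !mulg1.
  rewrite F_spec.
  have <- : zip (iota 0 n) (nseq n false) = scode (1%g : 'S_n) set0.
    apply: (@eq_from_nth _ (0, false)) => [|i].
      by rewrite size_zip size_iota size_nseq minnn size_map size_enum_ord.
    rewrite size_zip size_iota size_nseq minnn => lt_in.
    rewrite nth_zip ?size_iota ?size_nseq // nth_iota // nth_nseq lt_in.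
    by rewrite (nth_scode _ _ (Ordinal lt_in)) perm1 inE.
  set x := zip _ _.
  have rR : (normal_form x).2 \in distinct [seq d.2.2 | d <- class_data].
    rewrite mem_distinct -map_comp; apply/mapP; exists x => //.
    rewrite mem_signed_perms /signed_perm unzip1_zip ?size_iota ?size_nseq //.
  have := allP g_ok _ (map_f (fun r => (r, fix_number n _ r)) rR).
  by rewrite /= eqxx /= => /eqP <-.
- apply: (orbits_of_check (Q := fun U => U \in [set set0]) _ _ a_ok) => [s U|].
  2: exact: relabel_group_sperm.
  rewrite /= inE /untwisted /unzip2 -map_comp has_map.
  apply/eqP/hasPn => [-> i _|U0].
    by rewrite /= inE.
  by apply/setP => i; rewrite inE; apply/negbTE/U0; rewrite mem_enum.
- apply: (orbits_of_check (Q := fun U => U \in [set set0; setT]) _ _ b_ok).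
  1: move=> s U.
  2: exact: twisted_group_sperm.
  rewrite /= !inE /diagonal /unzip2 -map_comp has_map all_map; congr (_ || _).
    apply/eqP/hasPn => [-> i _|U0]; first by rewrite /= inE.
    by apply/setP => i; rewrite inE; apply/negbTE/U0; rewrite mem_enum.
  apply/eqP/allP => [-> i _|U1]; first by rewrite /= inE.
  by apply/setP => i; rewrite inE; apply/U1; rewrite mem_enum.
- apply: (orbits_of_check (Q := fun U => U \in setT) _ _ c_ok) => [s U|].
  2: exact: hyperoctahedral_group_sperm.
  by rewrite /= inE.
Qed.

End Census.

(** * The counts *)

(** The large literals of the theorem are decimal strings, converted to unary
numbers by [Nat.of_num_uint]. They are replaced by binary numbers through this
conversion, since their unary values are too large to be computed. *)
Fixpoint bin_of_digits (d : Decimal.uint) (s : N) : N :=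
  let shift c d' :=
    bin_of_digits d' (addN (bin_of_nat c) (mulN (bin_of_nat 10) s)) in
  match d with
  | Decimal.Nil => s
  | Decimal.D0 d' => shift 0 d'
  | Decimal.D1 d' => shift 1 d'
  | Decimal.D2 d' => shift 2 d'
  | Decimal.D3 d' => shift 3 d'
  | Decimal.D4 d' => shift 4 d'
  | Decimal.D5 d' => shift 5 d'
  | Decimal.D6 d' => shift 6 d'
  | Decimal.D7 d' => shift 7 d'
  | Decimal.D8 d' => shift 8 d'
  | Decimal.D9 d' => shift 9 d'
  end.

Definition binary (x : Number.uint) : N :=
  if x is Number.UIntDecimal d then bin_of_digits d N0 else N0.
Arguments binary x%_dec_uint_scope.

Lemma tail_addE m n : Nat.tail_add m n = m + n.
Proof. by elim: m n => //= m IHm n; rewrite IHm addnS. Qed.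

Lemma tail_mulE m n : Nat.tail_mul m n = m * n.
Proof.
suff addmulE r : Nat.tail_addmul r m n = r + m * n by exact: addmulE.
elim: m r => [|m IHm] r /=; rewrite ?addn0 //.
by rewrite IHm tail_addE mulSn addnCA addnA.
Qed.

Lemma nat_of_number d :
  Nat.of_num_uint (Number.UIntDecimal d) = binary (Number.UIntDecimal d).
Proof.
have shiftE k s : addN (bin_of_nat k) (mulN (bin_of_nat 10) s) =
    k + Nat.tail_mul 10 s :> nat.
  by rewrite addNE mulNE !bin_of_natK tail_mulE.
rewrite -[LHS]/(Nat.of_uint_acc d (nat_of_bin N0)).
rewrite -[RHS]/(nat_of_bin (bin_of_digits d N0)).
by elim: d (N0) => [|d IHd|d IHd|d IHd|d IHd|d IHd|d IHd|d IHd|d IHd|d IHd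
                   |d IHd] s //;
  apply: etrans (IHd _); rewrite shiftE.
Qed.

Lemma census_check5 : census_check 5 (binary 60212776)
  (binary 508817) (binary 254826) (binary 16981).
Proof. vm_cast_no_check (erefl true). Qed.

Theorem theorem4p1 :
  [/\ [/\ #|gaussoids 3| = 11,
          num_orbits (relabel_group 3) = 5,
          num_orbits (twisted_group 3) = 4
        & num_orbits (hyperoctahedral_group 3) = 4],
      [/\ #|gaussoids 4| = 679,
          num_orbits (relabel_group 4) = 58,
          num_orbits (twisted_group 4) = 42
        & num_orbits (hyperoctahedral_group 4) = 19]
    & [/\ #|gaussoids 5| = 60212776,
          num_orbits (relabel_group 5) = 508817,
          num_orbits (twisted_group 5) = 254826
        & num_orbits (hyperoctahedral_group 5) = 16981]].
Proof.
rewrite !nat_of_number; split; last exact: census census_check5.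
  apply: (census (n := 3) (g := bin_of_nat 11) (a := bin_of_nat 5)
    (b := bin_of_nat 4) (c := bin_of_nat 4)).
  by vm_compute.
apply: (census (n := 4) (g := bin_of_nat 679) (a := bin_of_nat 58)
  (b := bin_of_nat 42) (c := bin_of_nat 19)).
by vm_compute.
Qed.
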